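(* For any regular oriented matroid $N=(A,\mathfrak{C})$, as polynomials in $q$, \[\chi^\geq_N(-q)=\sum_{T\subseteq A\ \text{cyclic flat of }N}(-1)^{\mathrm{rk}(N)-\mathrm{rk}(T)}\chi^>_{N_{/T}}(q).\]
   Context: An oriented matroid $N=(A,\mathfrak{C})$ has signed circuits $C=(C^+,C^-)$; it is regular if representable over $\mathbb{R}$ by a totally unimodular matrix. For a positive integer $q$, a $q$-coflow is $f:A\to\mathbb{Z}/q\mathbb{Z}$ with $\sum_{a\in C^+}f(a)-\sum_{a\in C^-}f(a)=0$ for all signed circuits $C$. The strict-characteristic polynomial $\chi^>_N$ and weak-characteristic polynomial $\chi^\geq_N$ are the polynomials such that for every odd positive integer $q$, $\chi^>_N(q)$ is the number of $q$-coflows with all values in $\{1,\ldots,\lfloor q/2\rfloor\}$ (mod $q$), and $\chi^\geq_N(q)$ is the number of $q$-coflows with all values in $\{0,1,\ldots,\lfloor q/2\rfloor\}$ (such polynomials exist and are unique). A positive circuit is a signed circuit with $C^-=\emptyset$. A flat is a set $S\subseteq A$ with $\mathrm{rk}(S\cup\{a\})>\mathrm{rk}(S)$ for all $a\notin S$; a cyclic flat is a flat which is a union of supports of positive circuits of $N$ (equivalently, a flat whose restriction is totally cyclic). $N_{/T}$ is the contraction of $T$. *)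

(* Defs.v *)
From HB Require Import structures.
From mathcomp Require Import classical_sets reals.
From mathcomp Require Import all_boot all_order all_algebra.

Set Implicit Arguments.
Unset Strict Implicit.
Unset Printing Implicit Defensive.

Import Order.TTheory GRing.Theory Num.Theory.
Local Open Scope ring_scope.

(** A signed subset [X] of [A] is the pair [(X^+, X^-)]. *)
Definition signed_set (A : finType) : finType := ({set A} * {set A})%type.

Definition supp (A : finType) (X : signed_set A) : {set A} := X.1 :|: X.2.

Definition sopp (A : finType) (X : signed_set A) : signed_set A := (X.2, X.1).

(** An oriented matroid with ground set [A] is given by the set [N] of its
    signed circuits, subject to the circuit axioms. *)
Record oriented_matroid (A : finType) (N : {set signed_set A}) : Prop := {
  om_disjoint : forall X, X \in N -> [disjoint X.1 & X.2];
  om_nonempty : forall X, X \in N -> supp X != set0;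
  om_symmetric : forall X, X \in N -> sopp X \in N;
  om_incomparable : forall X Y, X \in N -> Y \in N ->
    supp X \subset supp Y -> X = Y \/ X = sopp Y;
  om_elimination : forall X Y e, X \in N -> Y \in N -> X <> sopp Y ->
    e \in X.1 :&: Y.2 ->
    exists2 Z, Z \in N &
      (Z.1 \subset (X.1 :|: Y.1) :\ e) && (Z.2 \subset (X.2 :|: Y.2) :\ e)
}.

Definition totally_unimodular (R : nzRingType) m n (M : 'M[R]_(m, n)) : Prop :=
  forall k (f : 'I_k -> 'I_m) (g : 'I_k -> 'I_n), injective f -> injective g ->
    \det (mxsub f g M) \in [:: 0; 1; -1].

Section Representation.

Variables (R : realType) (A : finType).

(** Coordinates (and matrix columns) are indexed by [A] through [enum_rank]. *)
Definition sign_vector (v : 'cV[R]_#|A|) : signed_set A :=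
  ([set a | 0 < v (enum_rank a) 0], [set a | v (enum_rank a) 0 < 0]).

(** [v] is a nonzero linear dependency, of minimal support, between the columns
    of [M]. *)
Definition minimal_dependency m (M : 'M[R]_(m, #|A|)) (v : 'cV[R]_#|A|) : Prop :=
  [/\ M *m v = 0, v != 0 &
      forall w : 'cV[R]_#|A|, M *m w = 0 -> w != 0 ->
        supp (sign_vector w) \subset supp (sign_vector v) ->
        supp (sign_vector w) = supp (sign_vector v)].

Definition represents m (M : 'M[R]_(m, #|A|)) (N : {set signed_set A}) : Prop :=
  forall X : signed_set A,
    X \in N <-> exists2 v, minimal_dependency M v & X = sign_vector v.

Definition regular (N : {set signed_set A}) : Prop :=
  exists m (M : 'M[R]_(m, #|A|)), totally_unimodular M /\ represents M N.

End Representation.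

Section Matroid.

Variables (A : finType) (N : {set signed_set A}).

Definition independent (S : {set A}) : bool :=
  [forall C in N, ~~ (supp C \subset S)].

Definition rk (S : {set A}) : nat :=
  \max_(I : {set A} | (I \subset S) && independent I) #|I|.

Definition flat (S : {set A}) : bool :=
  [forall a, (a \notin S) ==> (rk S < rk (a |: S))%N].

Definition positive_circuit (C : signed_set A) : bool :=
  (C \in N) && (C.2 == set0).

Definition cyclic_flat (S : {set A}) : bool :=
  flat S &&
  [exists P : {set signed_set A},
     [forall C in P, positive_circuit C] && (S == \bigcup_(C in P) supp C)].

Definition sdiff (T : {set A}) (X : signed_set A) :
    signed_set {a : A | a \notin T} :=
  ([set x | val x \in X.1], [set x | val x \in X.2]).

(** The signed circuits of the contraction of [T], on the ground set [A \ T]: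
    the nonempty signed sets [C \ T], for [C] a signed circuit, of minimal
    support. *)
Definition contract (T : {set A}) : {set signed_set {a : A | a \notin T}} :=
  let D := [set X in [set sdiff T C | C in N] | supp X != set0] in
  [set X in D | [forall Y in D, (supp Y \subset supp X) ==> (supp Y == supp X)]].

(** For [q > 0], the additive group ['I_q.-1.+1] is Z/qZ, and an element is, as a
    natural number, its representative in [0, q-1].  (['Z_q] would be wrong for
    [q = 1]: ['Z_1] is Z/2Z.) *)
Definition coflow (q : nat) (f : {ffun A -> 'I_q.-1.+1}) : bool :=
  [forall C in N, \sum_(a in C.1) f a - \sum_(a in C.2) f a == 0].

Definition strict_count (q : nat) : nat :=
  #|[set f : {ffun A -> 'I_q.-1.+1} |
      coflow f && [forall a, (1 <= f a <= q./2)%N]]|.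

Definition weak_count (q : nat) : nat :=
  #|[set f : {ffun A -> 'I_q.-1.+1} |
      coflow f && [forall a, (0 <= f a <= q./2)%N]]|.

(** The polynomial with the prescribed values at the odd positive integers; it
    is unique when it exists, and [0] is the default value otherwise. *)
Definition strict_charpoly : {poly rat} :=
  xget 0 (fun p : {poly rat} =>
    forall q : nat, odd q -> p.[q%:R] = (strict_count q)%:R).

Definition weak_charpoly : {poly rat} :=
  xget 0 (fun p : {poly rat} =>
    forall q : nat, odd q -> p.[q%:R] = (weak_count q)%:R).

End Matroid.

(* Main.v *)
From HB Require Import structures.
Require Import Defs.
From mathcomp Require Import reals.
From mathcomp Require Import all_boot all_order all_algebra.
From mathcomp Require Import boolp classical_sets functions cardinality fsbigop.
From mathcomp Require Import zify ring lra.

(** A weak coflow [f] modulo an odd [q] is a lattice point of height [q] in one of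
    finitely many cones ("cells"): the point has coordinates [2 f], [q - 2 f] and
    [q], and the cell records the integers [k_C] such that the sum of [f] over the
    signed circuit [C] equals [k_C q].  Total unimodularity makes the vertices of
    the cells 0/1 vectors.

    Attach to a cone of dimension [d] the function on lattice points that is 1 on
    the closed cone and [- (-1)^d] on the opposite of its relative interior.  Its
    sum over the points of height [q] (with prescribed parities) is polynomial in
    [q] of a given parity, for all [q] in [Z], positive and negative.  This is
    proved for half-open cones, by induction on the dimension: subtracting the
    translate by a 0/1 vertex [v] leaves exactly the analogous functions of the
    facets that avoid [v], made half-open by projecting the viewpoint along [v].

    Hence the number of weak coflows in a cell, evaluated at [- q], counts up to the
    sign [(-1)^(d-1)] the coflows in the relative interior of the cell.  The zero
    set of such a coflow is a cyclic flat [T] (by Minty's painting lemma), the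
    dimension is [d = rk N - rk T + 1], and strict coflows of [N / T] are the weak
    coflows of [N] with zero set [T]. *)

Set Implicit Arguments.
Unset Strict Implicit.
Unset Printing Implicit Defensive.

Import Order.TTheory GRing.Theory Num.Theory.
Local Open Scope ring_scope.

(** * Quasi-polynomial sums over lattice points *)

(** The rising factorials [rf k], that is $x(x+1)\cdots(x+k-1)$, are a basis adapted to backward
    differences: that of [rf k.+1] is [k.+1] times [rf k]. The leading term is thus removed, by
    induction on the size. *)
Lemma poly_antidifference (P : {poly rat}) :
  exists Q : {poly rat}, forall x : rat, Q.[x] - Q.[x - 1] = P.[x].
Proof.
pose rf k : {poly rat} := \prod_(i <- iota 0 k) ('X - (- i%:R)%:P).
have rfS k x : (rf k.+1).[x] = (rf k).[x] * (x + k%:R).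
  by rewrite /rf -addn1 iotaD big_cat big_seq1 /= !hornerE opprK.
have rfV k x : x * (rf k).[x + 1] = (rf k).[x] * (x + k%:R).
  elim: k => [|k IHk]; first by rewrite /rf /= big_nil !hornerC mulrC addr0.
  by rewrite !rfS mulrA IHk -natr1; ring.
have rfB k x : (rf k.+1).[x] - (rf k.+1).[x - 1] = k.+1%:R * (rf k).[x].
  have := rfV k (x - 1); rewrite subrK => rfx.
  by rewrite [X in _ - X]rfS -rfx rfS -natr1; ring.
have [n] := ubnP (size P); elim: n P => // n IHn P sP.
have [->|nzP] := eqVneq P 0; first by exists 0 => x; rewrite !horner0 subr0.
pose k := (size P).-1.
have sPk : size P = k.+1 by rewrite prednK // lt0n size_poly_eq0.
have srf : size (rf k) = k.+1 by rewrite /rf size_prod_XsubC size_iota.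
have mrf : rf k \is monic by apply: monic_prod_XsubC.
have [| Q HQ] := IHn (P - lead_coef P *: rf k)%R.
  suff: (size (P - lead_coef P *: rf k)%R <= k)%N by lia.
  apply/leq_sizeP => j; rewrite leq_eqVlt => /orP[/eqP <-|ltkj].
    rewrite coefB coefZ; move/monicP: mrf; rewrite /lead_coef srf /= => ->.
    by rewrite mulr1 -/k subrr.
  by rewrite coefB coefZ !nth_default ?mulr0 ?subr0 ?srf ?sPk.
exists (Q + (lead_coef P / k.+1%:R) *: rf k.+1) => x.
rewrite !hornerE opprD addrACA HQ -mulrBr rfB.
by rewrite [X in _ + X]mulrA divfK ?pnatr_eq0 // !hornerE subrK.
Qed.

Lemma int_step_const (T : Type) (F : int -> T) :
  (forall m, F m = F (m - 1)) -> forall m, F m = F 0.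
Proof.
move=> FB; elim/int_ind => [//|n IHn|n IHn].
  by rewrite [LHS]FB -IHn; congr F; lia.
by rewrite -IHn [RHS]FB; congr F; lia.
Qed.

Section IntFfun.

Variable I : finType.
Implicit Types g h : {ffun I -> int}.

Lemma ffun_addE g h i : (g + h) i = g i + h i :> int. Proof. by rewrite ffunE. Qed.

Lemma ffun_oppE g i : (- g) i = - g i :> int. Proof. by rewrite ffunE. Qed.

Lemma ffun_subE g h i : (g - h) i = g i - h i :> int.
Proof. by rewrite ffun_addE ffun_oppE. Qed.

End IntFfun.

Section QuasiPolynomial.

Variables (I : finType) (i0 : I).

Local Notation G := {ffun I -> int}.

Implicit Types (phi psi : G -> int) (w : G -> int) (g v : G).

Definition periodic2 w := forall g v, w (g + (v + v)) = w g.

Definition bounded phi :=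
  exists B : nat, forall g, phi g != 0 -> forall i, `|g i| <= `|g i0| + B%:Z.

(** The coordinate [i0] is the height. On an infinite support this sum takes a default value;
    [bounded] excludes that by making the slices of fixed height finite. *)
Definition hsum phi (q : int) : int :=
  \sum_(g \in [set: G]) (if g i0 == q then phi g else 0).

Lemma box_finite (B : nat) : finite_set [set g : G | forall i, `|g i| <= B%:Z]%classic.
Proof.
pose h (t : {ffun I -> 'I_(B + B).+1}) : G := [ffun i => (t i : nat)%:Z - B%:Z].
apply: (@sub_finite_set _ _ (h @` setT)%classic); last first.
  by apply: finite_image; apply: finite_finset.
move=> g /= gB; exists [ffun i => inord (absz (g i + B%:Z))] => //.
apply/ffunP => i; rewrite !ffunE inordK; first by have := gB i; lia.
by have := gB i; lia.
Qed.

Lemma hsum_box phi q (B : nat) :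
  (forall g, phi g != 0 -> g i0 = q -> forall i, `|g i| <= B%:Z) ->
  hsum phi q = \sum_(g \in [set g : G | forall i, `|g i| <= B%:Z]%classic)
                 (if g i0 == q then phi g else 0).
Proof.
move=> HB; symmetry; apply: fsbig_widen => // g [_ /= gB].
case: eqP => // gq; apply: contra_notP gB => /eqP nz i; exact: HB.
Qed.

Lemma bounded_box phi q : bounded phi -> exists B0 : nat, forall B : nat,
  (B0 <= B)%N -> forall g, phi g != 0 -> g i0 = q -> forall i, `|g i| <= B%:Z.
Proof.
move=> [B HB]; exists (absz q + B)%N => B' leB g /HB gB gq i.
by have := gB i; rewrite gq; lia.
Qed.

Lemma hsumD phi psi q : bounded phi -> bounded psi ->
  hsum (fun g => phi g + psi g) q = hsum phi q + hsum psi q.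
Proof.
move=> /(@bounded_box _ q)[B1 H1] /(@bounded_box _ q)[B2 H2].
rewrite !(@hsum_box _ q (B1 + B2)); last 3 first.
- by apply: H2; lia.
- by apply: H1; lia.
- move=> g gnz; have [p0|p0] := eqVneq (phi g) 0.
    by apply: H2; [lia|move: gnz; rewrite p0 add0r].
  by apply: H1; [lia|].
rewrite -fsbig_split; last exact: box_finite.
by apply: eq_fsbigr => g _; case: ifP; rewrite ?addr0.
Qed.

Lemma hsum_shift phi v q : v i0 = 1 ->
  hsum (fun g => phi (g - v)) q = hsum phi (q - 1).
Proof.
move=> v1; rewrite /hsum (@reindex_fsbigT _ _ _ _ _ (fun g : G => g + v)).
  by apply: eq_fsbigr => g _; rewrite addrK !ffunE v1 eq_sym -subr_eq eq_sym.
by exists (fun g : G => g - v) => g; rewrite ?addrK ?subrK.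
Qed.

Lemma eq_hsum phi psi q : phi =1 psi -> hsum phi q = hsum psi q.
Proof. by move=> /funext ->. Qed.

Lemma hsum0 phi q : (forall g, g i0 = q -> phi g = 0) -> hsum phi q = 0.
Proof. by move=> phi0; apply: fsbig1 => g _; case: eqP => // /phi0. Qed.

(** All weights of period 2 are quantified over, since translating [phi] translates the weight. As
    [m] may be negative, one polynomial governs heights of both signs. *)
Definition quasi_polynomial phi := bounded phi /\
  forall w, periodic2 w -> forall r : int, exists P : {poly rat},
  forall m : int, (hsum (fun g => phi g * w g) (m + m + r))%:~R = P.[m%:~R].

Lemma bounded_mul phi w : bounded phi -> bounded (fun g => phi g * w g).
Proof. by move=> [B HB]; exists B => g; rewrite mulf_eq0 negb_or => /andP[/HB]. Qed.

Lemma boundedD phi psi : bounded phi -> bounded psi ->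
  bounded (fun g => phi g + psi g).
Proof.
move=> [B HB] [B' HB']; exists (B + B')%N => g gnz i.
have [p0|/HB/(_ i)] := eqVneq (phi g) 0; last by lia.
by move: gnz; rewrite p0 add0r => /HB'/(_ i); lia.
Qed.

Lemma bounded_shift phi v : bounded phi -> bounded (fun g => phi (g - v)).
Proof.
move=> [B HB]; exists (B + absz (v i0) + \sum_i absz (v i))%N => g /HB gB i.
have vi : (absz (v i) <= \sum_i absz (v i))%N by rewrite (bigD1 i) //= leq_addr.
by move: (gB i) vi; rewrite !ffun_subE; move: (\sum_i absz (v i))%N => s; lia.
Qed.

Lemma periodic2_shift w v : periodic2 w -> periodic2 (fun g => w (g + v)).
Proof. by move=> wP g u; rewrite addrAC wP. Qed.

Lemma quasi_polynomial_ext phi psi : phi =1 psi ->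
  quasi_polynomial phi -> quasi_polynomial psi.
Proof. by move=> /funext ->. Qed.

Lemma quasi_polynomial0 : quasi_polynomial (fun=> 0).
Proof.
split=> [|w wP r]; first by exists 0%N => g; rewrite eqxx.
by exists 0 => m; rewrite hsum0 ?horner0 // => g _; rewrite mul0r.
Qed.

Lemma quasi_polynomialD phi psi : quasi_polynomial phi -> quasi_polynomial psi ->
  quasi_polynomial (fun g => phi g + psi g).
Proof.
move=> [bphi Hphi] [bpsi Hpsi]; split=> [|w wP r]; first exact: boundedD.
have [P HP] := Hphi w wP r; have [Q HQ] := Hpsi w wP r.
exists (P + Q) => m; rewrite hornerD -HP -HQ -intrD -hsumD; try exact: bounded_mul.
by congr _%:~R; apply: eq_hsum => g; rewrite mulrDl.
Qed.

Lemma quasi_polynomial_sum (J : Type) (s : seq J) (a : pred J) (phi : J -> G -> int) :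
  (forall j, a j -> quasi_polynomial (phi j)) ->
  quasi_polynomial (fun g => \sum_(j <- s | a j) phi j g).
Proof.
move=> Hphi; elim: s => [|j s IHs].
  by apply: quasi_polynomial_ext quasi_polynomial0 => g; rewrite big_nil.
have [aj|naj] := boolP (a j).
  apply: quasi_polynomial_ext (quasi_polynomialD (Hphi j aj) IHs) => g.
  by rewrite big_cons aj.
by apply: quasi_polynomial_ext IHs => g; rewrite big_cons (negbTE naj).
Qed.

Lemma hsum_mul_shift phi w v q : v i0 = 1 ->
  hsum (fun g => phi (g - v) * w g) q = hsum (fun g => phi g * w (g + v)) (q - 1).
Proof.
by move=> v1; rewrite -(hsum_shift _ _ v1); apply: eq_hsum => g; rewrite subrK.
Qed.

Lemma quasi_polynomial_shift phi v : v i0 = 1 -> quasi_polynomial phi ->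
  quasi_polynomial (fun g => phi (g - v)).
Proof.
move=> v1 [bphi Hphi]; split=> [|w wP r]; first exact: bounded_shift.
have [P HP] := Hphi _ (periodic2_shift v wP) (r - 1).
by exists P => m; rewrite -HP hsum_mul_shift // -addrA.
Qed.

(** A weight is invariant under [v + v] but perhaps not under [v], so two steps are added: one with
    [w], then one with [w] translated by [v]. Together they give a polynomial difference in [m], and
    an antidifference determines the sum up to a constant. *)
Lemma quasi_polynomial_step phi psi v : v i0 = 1 -> bounded phi ->
  (forall g, phi g - phi (g - v) = psi g) -> quasi_polynomial psi ->
  quasi_polynomial phi.
Proof.
move=> v1 bphi phiB qpsi; split=> // w wP r.
pose H w q := hsum (fun g => phi g * w g) q.
have HB u q : H u q - H (fun g => u (g + v)) (q - 1) = hsum (fun g => psi g * u g) q.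
  apply/eqP; rewrite subr_eq /H -hsum_mul_shift // -hsumD; last 2 first.
  - by apply: bounded_mul; case: qpsi.
  - by apply: bounded_mul; apply: bounded_shift.
  by apply/eqP/eq_hsum => g; rewrite -mulrDl -phiB subrK.
have wv : (fun g => w (g + v + v)) = w by apply: funext => g; rewrite -addrA wP.
have [_ Hpsi] := qpsi.
have [P1 HP1] := Hpsi _ wP r.
have [P2 HP2] := Hpsi _ (periodic2_shift v wP) (r - 1).
have [Q HQ] := poly_antidifference (P1 + P2).
pose F m : rat := (H w (m + m + r))%:~R - Q.[m%:~R].
have FB m : F m = F (m - 1).
  apply/eqP; rewrite -subr_eq0; apply/eqP.
  have := HQ m%:~R; rewrite hornerD -HP1 -HP2 -!HB wv !intrB => HQm.
  rewrite /F intrB.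
  have -> : m - 1 + (m - 1) + r = m + m + (r - 1) - 1 by lia.
  move: HQm; have -> : m + m + r - 1 = m + m + (r - 1) by lia.
  by move=> HQm; rewrite mulr1z; lra.
exists (Q + (F 0)%:P) => m; rewrite hornerD hornerC -(int_step_const FB m) /F.
by rewrite -/(H _ _); ring.
Qed.

End QuasiPolynomial.

(** * Reciprocity for half-open cones *)

Lemma perturbation (R : realFieldType) (J : finType) (c d : J -> R) :
  exists2 e : R, 0 < e & forall j,
    (0 < c j -> 0 < c j + e * d j) /\ (c j < 0 -> c j + e * d j < 0).
Proof.
pose s := 1 + \sum_(j | c j != 0) `|d j| / `|c j|.
have s_gt0 : 0 < s.
  by rewrite ltr_pwDl // sumr_ge0 // => j _; rewrite divr_ge0.
exists s^-1; first by rewrite invr_gt0.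
have key j : c j != 0 -> `|s^-1 * d j| < `|c j|.
  move=> cj; rewrite normrM gtr0_norm ?invr_gt0 // mulrC ltr_pdivrMr //.
  rewrite mulrC -ltr_pdivrMr ?normr_gt0 // /s (bigD1 j) //= addrCA ltrDl.
  by rewrite ltr_pwDl // sumr_ge0 // => i _; rewrite divr_ge0.
move=> j; split=> cj.
  have := key j (lt0r_neq0 cj); rewrite (gtr0_norm cj) ltr_norml; lra.
have := key j (ltr0_neq0 cj); rewrite (ltr0_norm cj) ltr_norml; lra.
Qed.

Section Reciprocity.

Variables (R : realFieldType) (I : finType) (i0 : I).

Local Notation G := {ffun I -> int}.
Local Notation E := {ffun I -> R^o}.

Local Notation ind b := (GRing.natmul (1 : int) (nat_of_bool b)).

Definition coordinate (i : I) (x : E) : R^o := x i.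

Fact coordinate_is_linear i : linear (coordinate i).
Proof. by move=> a x y; rewrite /coordinate !ffunE. Qed.

HB.instance Definition _ i :=
  GRing.isLinear.Build R E R^o _ (coordinate i) (coordinate_is_linear i).

Definition hyperplane (i : I) : {vspace E} := lker (linfun (coordinate i)).

Lemma mem_hyperplane i (x : E) : (x \in hyperplane i) = (x i == 0).
Proof. by rewrite memv_ker lfunE. Qed.

Lemma dim_cap_hyperplane (V : {vspace E}) (x : E) i :
  x \in V -> x i != 0 -> \dim V = (\dim (V :&: hyperplane i)).+1.
Proof.
move=> xV xi; rewrite -(limg_ker_dim (linfun (coordinate i)) V) -addn1.
congr addn; apply/eqP; rewrite eqn_leq lt0n dimv_eq0; apply/andP; split.
  by rewrite -[1%N]/(dim R^o) -dimvf dimvS ?subvf.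
apply: contra xi => /eqP V0.
have := memv_img (linfun (coordinate i)) xV.
by rewrite V0 memv0 lfunE.
Qed.

Definition embed (g : G) : E := [ffun i => (g i)%:~R].

Lemma embedE g i : embed g i = (g i)%:~R. Proof. by rewrite ffunE. Qed.

Lemma embedB g h : embed (g - h) = embed g - embed h.
Proof. by apply/ffunP => i; rewrite !ffunE intrB. Qed.

Lemma embedN g : embed (- g) = - embed g.
Proof. by apply/ffunP => i; rewrite !ffunE intrN. Qed.

(* The half-open cone seen from [p]: the facets that separate [p] from the
   cone are removed. *)
Definition half_open (p : E) (g : G) : bool :=
  [forall i, ((0 < p i) ==> (0 <= g i)) && ((p i < 0) ==> (0 < g i))].

Lemma half_openP (p : E) (g : G) :
  reflect (forall i, (0 < p i -> 0 <= g i) /\ (p i < 0 -> 0 < g i)) (half_open p g).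
Proof.
apply: (iffP forallP) => H i; first by have /andP[/implyP ? /implyP ?] := H i.
by have [? ?] := H i; apply/andP; split; apply/implyP.
Qed.

Lemma half_open_ge0 (p : E) (g : G) i : half_open p g -> p i != 0 -> 0 <= g i.
Proof.
move=> /half_openP/(_ i)[h1 h2]; rewrite neq_lt => /orP[/h2/ltW//|/h1 //].
Qed.

(** * Slices of a half-open cone along a 0/1 vertex *)

Section Slicing.

Variables (V : {vspace E}) (v : G) (p : E).
Hypotheses (v01 : forall i, v i = 0 \/ v i = 1) (p_neq0 : forall i, v i = 1 -> p i != 0).
Hypothesis p_sep : forall i j, v i = 1 -> v j = 1 -> p i = p j ->
  forall x, x \in V -> x i = x j.

(** By [p_sep], coordinates in the support of [v] with equal values of [p] coincide on [V], so they
    cut out the same facet; the leader is the one representative that is counted. *)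
Definition leader (q : E) j :=
  (v j == 1) && [forall i, (v i == 1) && (q i == q j) ==> (enum_rank j <= enum_rank i)%N].

(** For [v j = 1], the projection of the viewpoint along [v] onto the hyperplane of coordinate
    [j]. *)
Definition slice_point (q : E) j : E := q - q j *: embed v.

Definition in_slice (q : E) j (g : G) := (g j == 0) && half_open (slice_point q j) g.

(** The half-open cone seen from [p + t v] for large [t]. The one seen from [p] lies between it and
    its translate by [v]. *)
Definition half_open0 (g : G) : bool :=
  [forall i, if v i == 1 then 0 <= g i else
    ((0 < p i) ==> (0 <= g i)) && ((p i < 0) ==> (0 < g i))].

Lemma slice_pointE (q : E) j i :
  slice_point q j i = if v i == 1 then q i - q j else q i.
Proof.
rewrite !ffunE; have [->|->] /= := v01 i; first by rewrite scaler0 subr0.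
by rewrite -[_ *: _]/(_ * _) mulr1.
Qed.

Lemma leader_inj i j : leader p i -> leader p j -> p i = p j -> i = j.
Proof.
move=> /andP[vi /forallP li] /andP[vj /forallP lj] pij.
have := li j; rewrite vj pij eqxx /= => lij.
have := lj i; rewrite vi pij eqxx /= => lji.
by apply/enum_rank_inj/val_inj/anti_leq; rewrite lij lji.
Qed.

Lemma leader_exists i : v i = 1 -> exists2 j, leader p j & p j = p i.
Proof.
move=> vi; pose P := [pred k | (v k == 1) && (p k == p i)].
have Pi : P i by rewrite /P /= vi !eqxx.
case: (arg_minnP (fun k => enum_rank k : nat) Pi) => j /andP[vj /eqP pj] jmin.
exists j => //; apply/andP; split=> //; apply/forallP => k; apply/implyP => /andP[vk pk].
by apply: jmin; rewrite /P /= vk -pj.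
Qed.

(** If [p i < p j], slice [j] has a negative viewpoint coordinate at [i] and demands [0 < g i],
    while slice [i] demands [g i = 0]. *)
Lemma in_slice_uniq i j (g : G) : leader p i -> leader p j ->
  in_slice p i g -> in_slice p j g -> i = j.
Proof.
move=> li lj /andP[/eqP gi /half_openP Hi] /andP[/eqP gj /half_openP Hj].
have vi : v i == 1 by case/andP: li.
have vj : v j == 1 by case/andP: lj.
apply: leader_inj => //; apply/eqP; rewrite eq_le !leNgt; apply/andP; split; apply/negP => ltp.
  by have [_] := Hi j; rewrite slice_pointE vj gj subr_lt0 => /(_ ltp).
by have [_] := Hj i; rewrite slice_pointE vi gi subr_lt0 => /(_ ltp).
Qed.

(** In slice [j], the value [p j] is the least one among the zeros of [g] in the support of [v].
    Hence [g] avoids the facets removed by [p] exactly when [p j] is positive. *)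
Lemma in_slice_half_open j (g : G) : embed g \in V -> leader p j -> in_slice p j g ->
  [/\ half_open0 g, ~~ half_open0 (g - v) & half_open p g = (0 < p j)].
Proof.
move=> gV /andP[/eqP vj _] /andP[/eqP gj /half_openP Hj].
have Hg i : v i = 1 -> 0 <= g i /\ (p i < p j -> 0 < g i).
  move=> vi; have := Hj i; rewrite slice_pointE vi eqxx subr_gt0 subr_lt0 => -[h1 h2].
  split=> //; case: (ltgtP (p i) (p j)) => [/h2/ltW//|/h1//|pij].
  by have := p_sep vi vj pij gV; rewrite !embedE gj => /eqP; rewrite intr_eq0 => /eqP->.
have Hg0 i : v i = 0 -> (0 < p i -> 0 <= g i) /\ (p i < 0 -> 0 < g i).
  by move=> vi; have := Hj i; rewrite slice_pointE vi.
split.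
- apply/forallP => i; case: (v01 i) => vi; rewrite vi /=; last by case: (Hg i vi).
  by have [h1 h2] := Hg0 i vi; apply/andP; split; apply/implyP.
- apply/negP => /forallP/(_ j); rewrite vj eqxx ffun_subE gj vj; lia.
- apply/half_openP/idP => [/(_ j)[_]|pj i].
    rewrite gj => pj; have := p_neq0 vj; rewrite neq_lt => /orP[/pj|//].
    by rewrite ltxx.
  case: (v01 i) => vi; first exact: Hg0.
  have [h1 h2] := Hg i vi; split=> // pi; apply: h2; exact: lt_trans pj.
Qed.

(** A point of [half_open0] with a zero in the support of [v] lies in the slice given by such a zero
    of least [p]. Off all slices there is no such zero, and subtracting [v] stays in the cone. *)
Lemma no_slice_half_open (g : G) : embed g \in V ->
  (forall j, leader p j -> ~~ in_slice p j g) ->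
  half_open0 g = half_open p g /\ half_open0 (g - v) = half_open p g.
Proof.
move=> gV noj.
have h0g : half_open0 (g - v) -> half_open p g.
  move=> /forallP H; apply/half_openP => i; have := H i.
  case: (v01 i) => vi; rewrite vi /= ffun_subE vi ?subr0; last by split=> _; lia.
  by case/andP => /implyP ? /implyP.
have hg0 : half_open p g -> half_open0 g.
  move=> H; apply/forallP => i; case: (v01 i) => vi; rewrite vi /=.
    by move/forallP: H; apply.
  exact: half_open_ge0 H (p_neq0 vi).
suff h00 : half_open0 g -> half_open0 (g - v).
  split; apply/idP/idP => //; first by move/h00.
  by move/hg0.
move=> /forallP H; apply/forallP => i; have := H i.
case: (v01 i) => vi; rewrite vi /= ffun_subE vi ?subr0 // => gi.
rewrite leNgt; apply/negP => gi1.
have {gi gi1}gi : g i == 0 by lia.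
pose P := [pred k | (v k == 1) && (g k == 0)].
have Pi : P i by rewrite /P /= vi gi.
case: (arg_minP p Pi) => k /andP[/eqP vk /eqP gk] kmin.
have [j lj pj] := leader_exists vk.
have vj : v j = 1 by case/andP: lj => /eqP.
have /negP := noj j lj; apply; apply/andP; split.
  by have := p_sep vj vk pj gV; rewrite !embedE gk => /eqP; rewrite intr_eq0.
apply/half_openP => l; rewrite slice_pointE pj; have := H l.
case: (v01 l) => vl; rewrite vl /=; first by case/andP => /implyP ? /implyP ?.
move=> gl; split=> // pl; rewrite lt_def gl andbT; apply/negP => gl0.
by have := kmin l; rewrite /P /= vl gl0 => /(_ isT); rewrite leNgt -subr_lt0 pl.
Qed.

(** The difference of [half_open0] and its translate is the disjoint union of the slices; the sign
    of [p j] tells whether slice [j] lies in [half_open p] or outside it. *)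
Lemma half_open_slices (g : G) : embed g \in V ->
  (ind (half_open p g) - ind (half_open0 (g - v)) =
     \sum_(j | leader p j && (0 < p j)) ind (in_slice p j g)) /\
  (ind (half_open0 g) - ind (half_open p g) =
     \sum_(j | leader p j && (p j < 0)) ind (in_slice p j g)).
Proof.
move=> gV; case: (pickP [pred j | leader p j && in_slice p j g]) => [j /andP[lj sj]|noj].
  have [-> /negbTE-> ->] := in_slice_half_open gV lj sj.
  have sumj (a : pred I) : \sum_(k | leader p k && a k) ind (in_slice p k g) = ind (a j).
    have [aj|naj] := boolP (a j).
      rewrite (bigD1 j) /= ?lj ?aj // sj big1 ?addr0 // => k /andP[/andP[lk _] nkj].
      by case: (boolP (in_slice p k g)) => // sk; case/eqP: nkj; apply: in_slice_uniq sk sj.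
    rewrite big1 // => k /andP[lk ak]; case: (boolP (in_slice p k g)) => // sk.
    by move: naj; rewrite -(in_slice_uniq lk lj sk sj) ak.
  have vj : v j = 1 by case/andP: lj => /eqP.
  rewrite [in X in X /\ _](sumj (fun k => 0 < p k)) [in X in _ /\ X](sumj (fun k => p k < 0)).
  rewrite subr0; split=> //.
  by have := p_neq0 vj; rewrite neq_lt => /orP[]pj; rewrite pj (lt_gtF pj).
have noj' j : leader p j -> ~~ in_slice p j g.
  by move=> lj; have := noj j; rewrite /= lj => /= ->.
have [-> ->] := no_slice_half_open gV noj'.
by rewrite subrr; split; rewrite big1 // => j /andP[/noj'/negbTE->].
Qed.

(** Telescoping through [half_open0 (g - v)]. *)
Lemma half_open_shift (g : G) : embed v \in V -> embed g \in V ->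
  ind (half_open p g) - ind (half_open p (g - v)) =
    \sum_(j | leader p j && (0 < p j)) ind (in_slice p j g) +
    \sum_(j | leader p j && (p j < 0)) ind (in_slice p j (g - v)).
Proof.
move=> vV gV; have [<- _] := half_open_slices gV.
have gvV : embed (g - v) \in V by rewrite embedB rpredB.
by have [_ <-] := half_open_slices gvV; rewrite addrA subrK.
Qed.

End Slicing.

Lemma leaderN v (p : E) j : leader v (- p) j = leader v p j.
Proof. by congr andb; apply: eq_forallb => i; rewrite !ffunE eqr_opp. Qed.

Lemma slice_pointN v (p : E) j : slice_point v (- p) j = - slice_point v p j.
Proof. by rewrite /slice_point ffunE scaleNr -opprD. Qed.

(* The first term lives at heights [>= 0], the second one at heights [<= 0]. *)
Definition reciprocal (V : {vspace E}) (p : E) (g : G) : int :=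
  if embed g \in V then
    (half_open p g)%:R - (-1) ^+ (\dim V) * (half_open (- p) (- g))%:R
  else 0.

(** Both terms of [reciprocal] obey [half_open_shift], the second one from the viewpoint [- p].
    Passing to a facet lowers the dimension by one, and this sign change is what makes the slices of
    the two terms recombine. *)
Lemma reciprocal_shift (V : {vspace E}) (v : G) (p : E) (g : G) : (forall i, v i = 0 \/ v i = 1) ->
  (forall i, v i = 1 -> p i != 0) ->
  (forall i j, v i = 1 -> v j = 1 -> p i = p j -> forall x, x \in V -> x i = x j) ->
  embed v \in V ->
  reciprocal V p g - reciprocal V p (g - v) =
  \sum_(j | leader v p j && (0 < p j))
     reciprocal (V :&: hyperplane j) (slice_point v p j) g +
  \sum_(j | leader v p j && (p j < 0))
     reciprocal (V :&: hyperplane j) (slice_point v p j) (g - v).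
Proof.
move=> v01 pn0 psep vV.
have rec_slice j h : leader v p j -> embed h \in V ->
    reciprocal (V :&: hyperplane j) (slice_point v p j) h =
    (in_slice v p j h)%:R + (-1) ^+ (\dim V) * (in_slice v (- p) j (- h))%:R.
  move=> /andP[/eqP vj _] hV; rewrite /reciprocal memv_cap hV mem_hyperplane embedE.
  rewrite intr_eq0 /in_slice ffun_oppE oppr_eq0 slice_pointN.
  have [hj|] := eqVneq (h j) 0; last by rewrite mulr0 addr0.
  rewrite /= (@dim_cap_hyperplane V _ j vV); last by rewrite embedE vj oner_neq0.
  by rewrite exprS mulN1r mulNr.
have [gV|gNV] := boolP (embed g \in V); last first.
  have gvV : embed (g - v) \notin V.
    apply: contra gNV => gvV.
    have -> : g = (g - v) - (- v) by rewrite opprK subrK.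
    by rewrite embedB embedN rpredB ?rpredN.
  rewrite /reciprocal (negbTE gNV) (negbTE gvV) subrr.
  by rewrite !big1 ?addr0 // => j _; rewrite memv_cap ?(negbTE gNV) ?(negbTE gvV).
have gvV : embed (g - v) \in V by rewrite embedB rpredB.
have vgV : embed (v - g) \in V by rewrite embedB rpredB.
under eq_bigr => j /andP[lj _] do rewrite rec_slice //.
under [X in _ = _ + X]eq_bigr => j /andP[lj _] do rewrite rec_slice //.
have := half_open_shift v01 pn0 psep vV gV.
have pn0N i : v i = 1 -> (- p) i != 0 by move=> vi; rewrite ffunE oppr_eq0 pn0.
have psepN i j : v i = 1 -> v j = 1 -> (- p) i = (- p) j ->
    forall x, x \in V -> x i = x j.
  by rewrite !ffunE => vi vj /oppr_inj; exact: psep.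
(* The opposite term is shifted at [v - g], because [v - g - v = - g]. Negating [p] exchanges the
   two families of slices, which puts each opposite slice next to its counterpart. *)
have := half_open_shift v01 pn0N psepN vV vgV.
have -> : v - g - v = - g by rewrite addrAC subrr sub0r.
have posN j : leader v (- p) j && (0 < (- p) j) = leader v p j && (p j < 0).
  by rewrite leaderN ffunE oppr_gt0.
have negN j : leader v (- p) j && ((- p) j < 0) = leader v p j && (0 < p j).
  by rewrite leaderN ffunE oppr_lt0.
rewrite (eq_bigl _ _ posN) (eq_bigl _ _ negN).
have -> : v - g = - (g - v) by rewrite opprB.
rewrite /reciprocal gV gvV !big_split /= -!mulr_sumr.
set s := (-1) ^+ _ => HN H.
have ringE (x y a b c c' d d' : int) : a - b = d' + c -> x - y = c' + d ->
    x - s * b - (y - s * a) = c' + s * c + (d + s * d') by move=> /eqP; rewrite subr_eq => /eqP-> /eqP; rewrite subr_eq => /eqP->; ring.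
exact: ringE HN H.
Qed.

(** While two coordinates agree at [p] but not on [V], a small move inside [V] separates them
    without merging other pairs or changing signs, so the number of agreeing pairs drops. *)
Lemma separating_point (V : {vspace E}) (p : E) : p \in V ->
  (forall i, p i = 0 -> forall x, x \in V -> x i = 0) ->
  exists2 p' : E, p' \in V &
    [/\ forall i, (0 < p' i) = (0 < p i), forall i, (p' i < 0) = (p i < 0) &
        forall i j, p' i = p' j -> forall x, x \in V -> x i = x j].
Proof.
pose S (q : E) := [set ij : I * I | q ij.1 == q ij.2].
have [n] := ubnP #|S p|; elim: n p => // n IHn p Sn pV p0.
have [sep|] := pselect (forall i j, p i = p j -> forall x, x \in V -> x i = x j).
  by exists p.
move=> /existsNP[i] /existsNP[j] /not_implyP[pij] /existsNP[x] /not_implyP[xV xij].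
have [e e0 He] := @perturbation R (I + I * I)%type
  (fun k => match k with inl k => p k | inr kl => p kl.1 - p kl.2 end)
  (fun k => match k with inl k => x k | inr kl => x kl.1 - x kl.2 end).
pose q : E := p + e *: x.
have qE k : q k = p k + e * x k by rewrite !ffunE.
have qpos k : (0 < q k) = (0 < p k) /\ (q k < 0) = (p k < 0).
  have [h1 h2] := He (inl k); rewrite -!qE in h1 h2.
  case: (ltgtP (p k : R) 0) => [pk|pk|pk].
  - by rewrite h2 // (lt_gtF (h2 pk)).
  - by rewrite h1 // (lt_gtF (h1 pk)).
  - by rewrite qE pk (p0 k pk x xV) mulr0 addr0 ltxx.
have [|||p' p'V [pos neg sep]] := IHn q.
- suff: (#|S q| < #|S p|)%N by move: Sn; rewrite ltnS; lia.
  apply/proper_card/fintype.properP; split.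
    apply/fintype.subsetP => -[k l]; rewrite !inE /= !qE => /eqP qkl.
    have [/= h1 h2] := He (inr (k, l)).
    case: (ltgtP (p k : R) (p l)) => // pkl.
      by have := h2 _; rewrite subr_lt0 => /(_ pkl); lra.
    by have := h1 _; rewrite subr_gt0 => /(_ pkl); lra.
  exists (i, j); rewrite !inE /= ?pij ?eqxx // !qE pij.
  apply/eqP => /addrI/(mulfI (lt0r_neq0 e0)) //.
- by rewrite rpredD ?rpredZ.
- move=> k qk y yV; apply: p0 => //; have [h1 h2] := qpos k.
  by move: h1 h2; rewrite qk ltxx; case: (ltgtP (p k : R) 0).
by exists p' => //; split=> // k; rewrite ?pos ?neg; case: (qpos k).
Qed.

(* [Z] selects a face of the cone [V /\ x >= 0]. *)
Definition vertexed (V : {vspace E}) : Prop :=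
  (forall x : E, x \in V -> (forall i, 0 <= x i) -> forall i, x i <= x i0) /\
  forall (Z : {set I}) (x : E), x \in V -> x != 0 -> (forall i, 0 <= x i) ->
    (forall i, i \in Z -> x i = 0) ->
    exists v : G, [/\ embed v \in V, forall i, v i = 0 \/ v i = 1, v i0 = 1 &
                      forall i, i \in Z -> v i = 0].

Lemma vertexed_hyperplane V j : vertexed V -> vertexed (V :&: hyperplane j).
Proof.
move=> [bnd vtx]; split=> [x|Z x]; rewrite memv_cap => /andP[xV].
  by move=> _; exact: bnd.
rewrite mem_hyperplane => /eqP xj xn0 x0 xZ.
have [|v [vV v01 v1 vZ]] := vtx (j |: Z) x xV xn0 x0.
  by move=> i /setU1P[->|/xZ].
exists v; split=> // [|i iZ]; last by apply: vZ; rewrite setU1r.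
by rewrite memv_cap vV mem_hyperplane embedE vZ ?setU11 ?mulr0z /=.
Qed.

Lemma half_open_embed_ge0 (V : {vspace E}) (p : E) (g : G) : embed g \in V ->
  (forall i, p i = 0 -> forall x, x \in V -> x i = 0) ->
  half_open p g -> forall i, 0 <= embed g i.
Proof.
move=> gV p0 hg i; have [pi|pi] := eqVneq (p i) 0; first by rewrite (p0 i pi).
by rewrite embedE ler0z; exact: half_open_ge0 hg pi.
Qed.

Lemma reciprocal_bounded (V : {vspace E}) (p : E) : vertexed V ->
  (forall i, p i = 0 -> forall x, x \in V -> x i = 0) ->
  bounded i0 (reciprocal V p).
Proof.
move=> [bnd _] p0.
have pN0 i : (- p) i = 0 -> forall x, x \in V -> x i = 0.
  by rewrite ffunE => /eqP; rewrite oppr_eq0 => /eqP; exact: p0.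
have key (q : E) (h : G) : (forall i, q i = 0 -> forall x, x \in V -> x i = 0) ->
    embed h \in V -> half_open q h -> forall i, `|h i| <= `|h i0|.
  move=> q0 hV hq i; have h0 := half_open_embed_ge0 hV q0 hq.
  have := bnd _ hV h0 i; have := h0 i; have := h0 i0.
  by rewrite !embedE !ler0z ler_int; lia.
exists 0%N => g; rewrite /reciprocal; case: ifP => // gV + i; rewrite addr0.
have [hp _|_] := boolP (half_open p g); first exact: key hp i.
have [hn _|_] := boolP (half_open (- p) (- g)); last by rewrite mulr0 subr0 eqxx.
by have := key _ _ pN0 _ hn i; rewrite embedN rpredN => /(_ gV); rewrite !ffun_oppE !normrN.
Qed.

Theorem reciprocal_quasi_polynomial (V : {vspace E}) (p : E) : vertexed V ->
  p \in V -> (forall i, p i = 0 -> forall x, x \in V -> x i = 0) ->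
  quasi_polynomial i0 (reciprocal V p).
Proof.
have [n] := ubnP (\dim V); elim: n V p => // n IHn V p Vn vV pV p0.
(* A cone reduced to the origin has no vertex to subtract; there [reciprocal] vanishes
   identically. *)
have [all0|] := pselect (forall x : E, x \in V -> (forall i, 0 <= x i) -> x = 0).
  apply: quasi_polynomial_ext (quasi_polynomial0 i0) => g; symmetry.
  rewrite /reciprocal; case: ifP => // gV.
  (* A point of the half-open cone must be the origin, so [q] has no negative coordinate; then [q]
     itself lies in the cone, hence is zero, and so is [V]. *)
  have zero_cone (q : E) (h : G) : (forall i, q i = 0 -> forall x, x \in V -> x i = 0) -> q \in V ->
      embed h \in V -> half_open q h -> \dim V = 0%N.
    move=> q0 qV hV hq.
    have h0 := all0 _ hV (half_open_embed_ge0 hV q0 hq).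
    have qge0 i : 0 <= q i.
      rewrite leNgt; apply/negP => qi; have /half_openP/(_ i)[_ /(_ qi)] := hq.
      by rewrite -(ltr0z R) -embedE h0 ffunE ltxx.
    have qE := all0 q qV qge0; apply/eqP; rewrite dimv_eq0 -subv0.
    apply/subvP => x xV; rewrite memv0; apply/eqP/ffunP => i.
    by rewrite ffunE (q0 i) // qE ffunE.
  have [dimV0|dimVn0] := eqVneq (\dim V) 0%N.
    have V0 : V = 0%VS by apply/eqP; rewrite -dimv_eq0 dimV0.
    have p_eq0 i : p i = 0 by move: pV; rewrite V0 memv0 => /eqP->; rewrite ffunE.
    have -> : half_open p g by apply/half_openP => i; rewrite p_eq0 ltxx.
    have -> : half_open (- p) (- g) by apply/half_openP => i; rewrite ffunE p_eq0 oppr0 ltxx.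
    by rewrite dimV0 expr0 mulr1 subrr.
  have -> : half_open p g = false.
    by apply/negP => /(zero_cone _ _ p0 pV gV); apply/eqP.
  have -> : half_open (- p) (- g) = false.
    apply/negP => /zero_cone H; move/eqP: dimVn0; apply; apply: H.
    - by move=> i; rewrite ffunE => /eqP; rewrite oppr_eq0 => /eqP; exact: p0.
    - by rewrite rpredN.
    - by rewrite embedN rpredN.
  by rewrite mulr0 subrr.
move=> /existsNP[x] /not_implyP[xV] /not_implyP[xge0 /eqP xn0].
have [_ /(_ finset.set0 x xV xn0 xge0)[|v [vinV v01 v1 _]]] := vV; first by move=> i; rewrite inE.
(* Only the signs of the viewpoint matter to [reciprocal], so a generic viewpoint with the same
   signs may be used for slicing. *)
have [q qV [qpos qneg qsep]] := separating_point pV p0.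
have q0 i : q i = 0 -> forall y, y \in V -> y i = 0.
  move=> qi; apply: p0; have := qpos i; have := qneg i; rewrite qi ltxx.
  by case: (ltgtP (p i : R) 0).
have half_open_q (g : G) : half_open q g = half_open p g.
  by apply: eq_forallb => i; rewrite qpos qneg.
have half_open_qN (g : G) : half_open (- q) g = half_open (- p) g.
  by apply: eq_forallb => i; rewrite !ffunE !oppr_gt0 !oppr_lt0 qpos qneg.
apply: (@quasi_polynomial_ext _ _ (reciprocal V q)).
  by move=> g; rewrite /reciprocal half_open_q half_open_qN.
have qn0 i : v i = 1 -> q i != 0.
  move=> vi; apply/eqP => qi; have := q0 i qi _ vinV; rewrite embedE vi.
  by move/eqP; rewrite oner_eq0.
have qsep' i j : v i = 1 -> v j = 1 -> q i = q j -> forall y, y \in V -> y i = y j.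
  by move=> _ _; exact: qsep.
apply: (quasi_polynomial_step v1 (reciprocal_bounded vV q0)
  (fun g => reciprocal_shift g v01 qn0 qsep' vinV)).
have slice_qp j : leader v q j ->
    quasi_polynomial i0 (reciprocal (V :&: hyperplane j) (slice_point v q j)).
  move=> /andP[/eqP vj _]; apply: IHn.
  - move: Vn; rewrite (@dim_cap_hyperplane V _ j vinV) ?embedE ?vj ?oner_eq0 //.
  - exact: vertexed_hyperplane.
  - rewrite memv_cap rpredB ?rpredZ // mem_hyperplane slice_pointE //.
    by rewrite vj eqxx subrr eqxx.
  move=> i; rewrite slice_pointE //; case: (v01 i) => vi; rewrite vi /=.
    by move=> qi y; rewrite memv_cap => /andP[yV _]; exact: q0.
  move=> /eqP; rewrite subr_eq0 => /eqP qij y; rewrite memv_cap mem_hyperplane.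
  by move=> /andP[yV /eqP<-]; exact: qsep.
apply: quasi_polynomialD.
  by apply: quasi_polynomial_sum => j /andP[lj _]; exact: slice_qp.
apply: quasi_polynomial_sum => j /andP[lj _].
exact: (quasi_polynomial_shift v1 (slice_qp j lj)).
Qed.

End Reciprocity.

(** * Circuits of a totally unimodular matrix *)

Definition circuit_vector (A : finType) (C : signed_set A) (a : A) : int :=
  (a \in C.1)%:R - (a \in C.2)%:R.

(** Move from [u] along [w] until the first coordinate whose sign conflicts with [w] reaches zero.
    No sign of [u] is reversed, and [a], which is not in conflict, survives. *)
Lemma conformal_step (R : realFieldType) (J : finType) (u w : J -> R) a b :
  (forall c, w c != 0 -> u c != 0) -> 0 <= u a * w a -> u a != 0 -> u b * w b < 0 ->
  exists t, [/\ u a + t * w a != 0,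
    exists2 c, u c != 0 & u c + t * w c = 0,
    forall c, 0 < u c + t * w c -> 0 < u c & forall c, u c + t * w c < 0 -> u c < 0].
Proof.
move=> wu ua uan0 ub.
have [c uc cmin] := @arg_minP _ R J b (fun c => u c * w c < 0) (fun c => - u c / w c) ub.
pose t := - u c / w c.
have neg_neq0 d : u d * w d < 0 -> w d != 0.
  by move=> ud; apply: contraTneq ud => ->; rewrite mulr0 ltxx.
have t_gt0 : 0 < t.
  have wc := neg_neq0 c uc.
  have -> : t = - (u c * w c) / (w c * w c) by rewrite /t; field.
  by rewrite divr_gt0 ?oppr_gt0 // -expr2 exprn_even_gt0.
have conf d : 0 <= u d * (u d + t * w d).
  have [ud|ud] := leP 0 (u d * w d).
    by rewrite mulrDr addr_ge0 ?sqr_ge0 // mulrCA mulr_ge0 // ltW.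
  have wd := neg_neq0 d ud.
  have -> : u d * (u d + t * w d) = (- (u d * w d)) * (- u d / w d - t) by field.
  by rewrite mulr_ge0 ?subr_ge0 ?oppr_ge0 ?(ltW ud) ?cmin.
exists t; split.
- apply: contra uan0 => /eqP uE; have : u a * (u a + t * w a) = 0 by rewrite uE mulr0.
  move/eqP; rewrite mulrDr paddr_eq0 ?sqr_ge0 ?mulf_eq0 ?orbb //.
    by case/andP.
  by rewrite mulrCA mulr_ge0 // ltW.
- by exists c; [exact/wu/neg_neq0|rewrite /t divfK ?subrr ?neg_neq0].
- move=> d ud; have := conf d; rewrite pmulr_lge0 // le_eqVlt => /orP[/eqP ud0|//].
  have [|wd] := eqVneq (w d) 0; first by move=> wd; move: ud; rewrite wd mulr0 addr0.
  by have := wu d wd; rewrite -ud0 eqxx.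
- move=> d ud; have := conf d; rewrite nmulr_lge0 // le_eqVlt => /orP[/eqP ud0|//].
  have [|wd] := eqVneq (w d) 0; first by move=> wd; move: ud; rewrite wd mulr0 addr0.
  by have := wu d wd; rewrite ud0 eqxx.
Qed.

Section RegularMatroid.

Variables (R : realType) (A : finType) (N : {set signed_set A}).
Variables (m : nat) (M : 'M[R]_(m, #|A|)).
Hypotheses (tuM : totally_unimodular M) (repM : represents M N).

Implicit Types (u w : A -> R) (a b c : A) (C : signed_set A).

Definition dependency u := forall i, \sum_a M i (enum_rank a) * u a = 0.

Definition row_vector (y : 'I_m -> R) a : R := \sum_i y i * M i (enum_rank a).

Definition column u : 'cV[R]_#|A| := \col_k u (enum_val k).

Lemma mulmx_column u : M *m column u = 0 <-> dependency u.
Proof.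
have E i : (M *m column u) i 0 = \sum_a M i (enum_rank a) * u a.
  rewrite mxE (reindex (@enum_rank A)) /=; last by apply: onW_bij; exact: enum_rank_bij.
  by apply: eq_bigr => a _; rewrite mxE enum_rankK.
split=> [H i|H]; first by rewrite -E H mxE.
by apply/colP => i; rewrite E H mxE.
Qed.

Lemma columnK (v : 'cV[R]_#|A|) : column (fun a => v (enum_rank a) 0) = v.
Proof. by apply/colP => k; rewrite mxE enum_valK. Qed.

Lemma column_neq0 u a : u a != 0 -> column u != 0.
Proof.
by apply: contraNneq => /colP/(_ (enum_rank a)); rewrite !mxE enum_rankK => ->.
Qed.

Lemma sign_vector_column u :
  sign_vector (column u) = ([set a | 0 < u a], [set a | u a < 0]).
Proof. by congr pair; apply/setP => a; rewrite !inE mxE enum_rankK. Qed.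

Lemma mem_supp_column u a : (a \in supp (sign_vector (column u))) = (u a != 0).
Proof. by rewrite sign_vector_column !inE orbC -neq_lt. Qed.

Lemma row_vector_orth y u : dependency u -> \sum_a row_vector y a * u a = 0.
Proof.
move=> du; under eq_bigr do rewrite mulr_suml.
rewrite exchange_big big1 //= => i _.
by under eq_bigr do rewrite -mulrA; rewrite -mulr_sumr du mulr0.
Qed.

Lemma dependencyD t u w : dependency u -> dependency w ->
  dependency (fun a => u a + t * w a).
Proof.
move=> du dw i; under eq_bigr do rewrite mulrDr mulrCA.
by rewrite big_split /= -mulr_sumr du dw mulr0 addr0.
Qed.

Lemma dependencyN u : dependency u -> dependency (fun a => - u a).
Proof. by move=> du i; under eq_bigr do rewrite mulrN; rewrite sumrN du oppr0. Qed.

(** Descent on the support. If [u] is not minimal, there is a nonzero dependency [w] of strictly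
    smaller support; either [w] replaces [u], or a conformal step along [w] or [- w] kills a
    coordinate of [u] and keeps [a]. *)
Theorem conformal_circuit u a : dependency u -> u a != 0 ->
  exists2 C, C \in N & [/\ a \in supp C, forall b, b \in C.1 -> 0 < u b &
                            forall b, b \in C.2 -> u b < 0].
Proof.
pose S (x : A -> R) := [set b | x b != 0].
have [n] := ubnP #|S u|; elim: n u => // n IHn u un du ua.
have descend u' : dependency u' -> u' a != 0 -> (forall b, 0 < u' b -> 0 < u b) ->
    (forall b, u' b < 0 -> u b < 0) -> (exists2 c, u c != 0 & u' c = 0) ->
    exists2 C, C \in N & [/\ a \in supp C, forall b, b \in C.1 -> 0 < u b &
                              forall b, b \in C.2 -> u b < 0].
  move=> du' u'a pos neg [c uc u'c].
  have [||//|C CN [aC C1 C2]] := IHn u'; last first.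
  - by exists C => //; split=> // b bC; [exact/pos/C1|exact/neg/C2].
  - by [].
  suff: (#|S u'| < #|S u|)%N.
    by move: un; rewrite ltnS; lia.
  apply/proper_card/fintype.properP; split.
    apply/fintype.subsetP => b; rewrite !inE neq_lt => /orP[/neg/ltr0_neq0//|/pos].
    exact: lt0r_neq0.
  by exists c; rewrite inE ?u'c ?eqxx.
have [minu|nmin] := pselect (minimal_dependency M (column u)).
  exists (sign_vector (column u)); first by apply/repM; exists (column u).
  by rewrite mem_supp_column sign_vector_column; split=> // b; rewrite inE.
have [w [dw [c wc] wu [d ud wd]]] : exists w, [/\ dependency w, exists c, w c != 0,
    forall c, w c != 0 -> u c != 0 & exists2 d, u d != 0 & w d = 0].
  apply: contra_notP nmin => now; split; first exact/mulmx_column.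
    exact: column_neq0 ua.
  move=> v Mv vn0 vu; apply/eqP; rewrite finset.eqEsubset vu /=.
  apply/fintype.subsetP => d ud; apply/negPn/negP => vd; apply: now.
  exists (fun b => v (enum_rank b) 0); rewrite -(columnK v) in Mv vn0 vu vd; split.
  - exact/mulmx_column.
  - apply: contra_notP (elimN eqP vn0) => v0; apply/colP => k; rewrite [RHS]mxE.
    rewrite mxE; apply/eqP/negPn/negP => vk; apply: v0; exists (enum_val k).
    by move: vk; rewrite !enum_valK.
  - by move=> b vb; rewrite -mem_supp_column (fintype.subsetP vu) // mem_supp_column.
  - exists d; first by rewrite -mem_supp_column.
    by move: vd; rewrite mem_supp_column negbK => /eqP.
wlog ua_wa : w c d wc wu ud wd dw / 0 <= u a * w a.
  move=> W; have [uw|uw] := leP 0 (u a * w a); first exact: (W w c d).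
  apply: (W (fun b => - w b) c d); rewrite ?oppr_eq0 ?wd ?oppr0 //.
  - by move=> b; rewrite oppr_eq0; exact: wu.
  - exact: dependencyN.
  - by rewrite mulrN oppr_ge0 ltW.
have step w' b : dependency w' -> (forall c, w' c != 0 -> u c != 0) ->
    0 <= u a * w' a -> u b * w' b < 0 ->
    exists2 C, C \in N & [/\ a \in supp C, forall b, b \in C.1 -> 0 < u b &
                              forall b, b \in C.2 -> u b < 0].
  move=> dw' w'u uwa uwb; have [t [ta tc tpos tneg]] := conformal_step w'u uwa ua uwb.
  by apply: (descend (fun b => u b + t * w' b)) => //; exact: dependencyD.
have [[b ub]|conf] := pselect (exists b, u b * w b < 0); first exact: (step w b).
have {}conf b : 0 <= u b * w b by rewrite leNgt; apply/negP => ub; apply: conf; exists b.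
have [wa|wa] := eqVneq (w a) 0; last first.
  apply: (descend w) => // [b wb|b wb|]; last by exists d.
    have := conf b; rewrite pmulr_lge0 // le_eqVlt => /orP[/eqP ub|//].
    by have := wu b (lt0r_neq0 wb); rewrite -ub eqxx.
  have := conf b; rewrite nmulr_lge0 // le_eqVlt => /orP[/eqP ub|//].
  by have := wu b (ltr0_neq0 wb); rewrite ub eqxx.
(* Here [w] conforms to [u] but misses [a]. Every nonzero coordinate of [- w] conflicts with [u], so
   a step along [- w] shrinks the support and leaves the value at [a] unchanged. *)
apply: (step (fun b => - w b) c).
- exact: dependencyN.
- by move=> b; rewrite oppr_eq0; exact: wu.
- by rewrite wa oppr0 mulr0.
- by rewrite mulrN oppr_lt0 lt_def conf mulf_neq0 // wu.
Qed.

Lemma circuit_minimal C : C \in N -> exists2 u, dependency u &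
  [/\ C.1 = [set a | 0 < u a], C.2 = [set a | u a < 0], (exists a, u a != 0) &
   forall w, dependency w -> (forall a, w a != 0 -> u a != 0) ->
     forall b, u b != 0 -> w b = 0 -> forall a, w a = 0].
Proof.
move=> /repM[v [Mv vn0 vmin] ->].
pose u a := v (enum_rank a) 0; have vE : v = column u by rewrite /u columnK.
exists u; first by apply/mulmx_column; rewrite -vE.
split; [by rewrite vE sign_vector_column | by rewrite vE sign_vector_column | |].
  apply: contra_notP (elimN eqP vn0) => u0; rewrite vE; apply/colP => k; rewrite !mxE.
  by apply/eqP/negPn/negP => uk; apply: u0; exists (enum_val k).
move=> w dw wu b ub wb a; apply/eqP/negPn/negP => wa.
have Mw : M *m column w = 0 by apply/mulmx_column.
have wv : supp (sign_vector (column w)) \subset supp (sign_vector v).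
  by apply/fintype.subsetP => c; rewrite vE !mem_supp_column; exact: wu.
have /setP/(_ b) := vmin _ Mw (column_neq0 wa) wv.
by rewrite vE !mem_supp_column wb eqxx ub.
Qed.

(** Cramer's rule. By minimality the columns of the support other than [b] are independent, so some
    rows make them a nonsingular square block [B]. Exchanging column [a] for column [b] gives [B']
    with [u b * \det B' = - (\det B * u a)], and total unimodularity makes both determinants [1] or
    [-1]. *)
Lemma circuit_normr u a b : dependency u -> u a != 0 -> u b != 0 ->
  (forall w, dependency w -> (forall a, w a != 0 -> u a != 0) ->
     forall b, u b != 0 -> w b = 0 -> forall a, w a = 0) ->
  `|u a| = `|u b|.
Proof.
move=> du ua ub umin; have [->//|nab] := eqVneq a b.
pose S := [set c | (u c != 0) && (c != b)].
pose ev : 'I_#|S| -> A := @enum_val A (mem S).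
pose g k : 'I_#|A| := enum_rank (ev k).
have evS k : ev k \in S := enum_valP k.
have gS k : u (ev k) != 0 /\ ev k != b by have := evS k; rewrite inE => /andP.
have g_inj : injective g by move=> i j /enum_rank_inj/enum_val_inj.
have aS : a \in S by rewrite inE ua nab.
pose t := enum_rank_in aS a.
have ev_rank c : c \in S -> ev (enum_rank_in aS c) = c by move=> cS; exact: enum_rankK_in.
have rank_ev k : enum_rank_in aS (ev k) = k by exact: enum_valK_in.
have evt : ev t = a by exact: ev_rank.
have sumS i (w : A -> R) : (forall c, c \notin S -> w c = 0) ->
    \sum_c M i (enum_rank c) * w c = \sum_k M i (g k) * w (ev k).
  move=> w0; rewrite (bigID (mem S)) /= [X in _ + X]big1 ?addr0; last first.
    by move=> c cS; rewrite w0 ?mulr0.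
  rewrite (reindex_onto (ev) (enum_rank_in aS)); last first.
    exact: ev_rank.
  by apply: eq_bigl => k; rewrite evS rank_ev eqxx.
pose B0 := colsub g M.
have full : row_full B0.
  rewrite -(trmxK B0) /row_full mxrank_tr; apply: inj_row_free => x xB.
  have dx i : \sum_k M i (g k) * x 0 k = 0.
    have := congr1 (fun X : 'rV_m => X 0 i) xB; rewrite !mxE => xBi; rewrite -[RHS]xBi.
    by apply: eq_bigr => k _; rewrite !mxE mulrC.
  pose w c := if c \in S then x 0 (enum_rank_in aS c) else 0.
  have wE k : w (ev k) = x 0 k by rewrite /w evS rank_ev.
  have dw : dependency w.
    move=> i; rewrite sumS => [|c /negbTE cS]; last by rewrite /w cS.
    by rewrite -[RHS](dx i); apply: eq_bigr => k _; rewrite wE.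
  apply/rowP => k; rewrite mxE -wE; apply: umin ub _ _ => //.
    by move=> c; rewrite /w; case: ifP; rewrite ?eqxx // inE => /andP[].
  by rewrite /w inE eqxx andbF.
pose f := fullrankfun full; pose B := mxsub f g M.
have f_inj : injective f by exact: fullrankfun_inj.
have detB0 : \det B != 0.
  have := fullrowsub_unit full; rewrite unitmxE unitfE.
  suff -> : rowsub (fullrankfun full) B0 = B by [].
  by apply/matrixP => i j; rewrite !mxE.
pose g' k := if k == t then enum_rank b else g k.
have g'_inj : injective g'.
  move=> i j; rewrite /g'; case: eqP => [->|_]; case: eqP => [->|_] //; last by move/g_inj.
    by move/enum_rank_inj => bE; have [_] := gS j; rewrite -bE eqxx.
  by move/enum_rank_inj => bE; have [_] := gS i; rewrite bE eqxx.
pose B' := mxsub f g' M.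
have unit_det (x : R) : x \in [:: 0; 1; -1] -> x = 0 \/ `|x| = 1.
  rewrite !inE => /or3P[]/eqP->; first by left.
    by right; rewrite normr1.
  by right; rewrite normrN1.
have cramer : u b * \det B' = - (\det B * u a).
  (* Laplace expansion along the exchanged column, whose cofactors are those of [B]. *)
  have detB' : \det B' = (\adj B *m \col_i M (f i) (enum_rank b)) t 0.
    rewrite (expand_det_col B' t) mxE; apply: eq_bigr => i _.
    rewrite !mxE mulrC /g' eqxx; congr (_ * _); congr (_ * \det _).
    by apply/matrixP => j k; rewrite !mxE /= /g' eq_sym (negbTE (neq_lift _ _)).
  have colb : u b *: (\col_i M (f i) (enum_rank b)) = - (B *m \col_k u (ev k)).
    apply/colP => i; rewrite !mxE; apply/eqP; rewrite -addr_eq0; apply/eqP.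
    have := du (f i); rewrite (bigD1 b) //= mulrC => du0; rewrite -[RHS]du0; congr (_ + _).
    have uS0 c : c \notin S -> (if c \in S then u c else 0) = 0 by move/negbTE->.
    have := sumS (f i) _ uS0.
    rewrite (bigD1 b) //= inE eqxx andbF mulr0 add0r => sumE.
    transitivity (\sum_k M (f i) (g k) *
        (if ev k \in S then u (ev k) else 0)).
      by apply: eq_bigr => k _; rewrite !mxE evS.
    rewrite -sumE; apply: eq_bigr => c cb; rewrite inE cb andbT.
    by have [->|] := eqVneq (u c) 0.
  rewrite detB'; transitivity ((\adj B *m (u b *: \col_i M (f i) (enum_rank b))) t 0).
    by rewrite -scalemxAr [RHS]mxE.
  rewrite colb mulmxN mulmxA mul_adj_mx mul_scalar_mx !mxE.
  by rewrite evt.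
have [detBz|detB1] := unit_det _ (tuM f_inj g_inj); first by rewrite detBz eqxx in detB0.
have [detB'0|detB'1] := unit_det _ (tuM f_inj g'_inj).
  move: cramer; rewrite detB'0 mulr0 => /eqP; rewrite eq_sym oppr_eq0 mulf_eq0.
  by rewrite (negbTE ua) (negbTE detB0).
by have := congr1 Num.norm cramer; rewrite normrN !normrM detB1 detB'1 mulr1 mul1r.
Qed.

(** The entries of a minimal dependency share one absolute value, so it is a multiple of the circuit
    vector. The rest of the proof uses total unimodularity through this fact. *)
Theorem circuit_vector_dependency C : C \in N ->
  dependency (fun a => (circuit_vector C a)%:~R).
Proof.
move=> /circuit_minimal[u du [C1 C2 [c uc] umin]].
have uE a : (circuit_vector C a)%:~R = `|u c|^-1 * u a.
  rewrite /circuit_vector C1 C2 !inE.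
  have [ua|ua|->] := ltgtP (u a) 0; last by rewrite mulr0.
  - rewrite -(circuit_normr du (ltr0_neq0 ua) uc umin) ltr0_norm // invrN mulNr.
    by rewrite mulVf ?ltr0_neq0.
  - by rewrite -(circuit_normr du (lt0r_neq0 ua) uc umin) gtr0_norm // mulVf ?lt0r_neq0.
move=> i; under eq_bigr => a _ do rewrite uE mulrCA.
by rewrite -mulr_sumr du mulr0.
Qed.

(** The linear alternative: column [a] lies in the span of the columns in [Z], or some combination
    of the rows vanishes on [Z] but not at [a]. *)
Lemma painting1 (Z : {set A}) a : a \notin Z ->
  (exists2 y, forall b, b \in Z -> row_vector y b = 0 & 0 < row_vector y a) \/
  (exists2 u, dependency u & (forall b, b \notin a |: Z -> u b = 0) /\ 0 < u a).
Proof.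
move=> aZ; pose MZ : 'M[R]_(m, #|A|) := \matrix_(i, k) (M i k *+ (enum_val k \in Z)).
pose ca : 'rV[R]_m := \row_i M i (enum_rank a).
have [/submxP[D caD]|ncaD] := boolP (ca <= MZ^T)%MS.
  right; exists (fun b => if b == a then 1 else if b \in Z then - D 0 (enum_rank b) else 0).
    move=> i; have := congr1 (fun X : 'rV_m => X 0 i) caD; rewrite !mxE.
    rewrite (bigD1 a) //= eqxx mulr1 => ->.
    rewrite (reindex (@enum_rank A)) /=; last by apply: onW_bij; exact: enum_rank_bij.
    rewrite (bigD1 a) //= !mxE enum_rankK (negbTE aZ) mulr0n mulr0 add0r -big_split /=.
    rewrite big1 // => b /negbTE->; rewrite !mxE enum_rankK; case: ifP => _.
      by rewrite mulr1n mulrN mulrC subrr.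
    by rewrite !mulr0 addr0.
  split=> [b|]; last by rewrite eqxx.
  by rewrite !inE negb_or => /andP[/negbTE-> /negbTE->].
left; have [K /rV0Pn[j Kj] MZK] : exists2 K : 'M_m, ca *m K != 0 & MZ^T *m K = 0.
  by exists (cokermx MZ^T); [rewrite -submxE | exact: mulmx_coker].
have sumE b (s : R) : row_vector (fun i => s * K i j) b = s * \sum_i M i (enum_rank b) * K i j.
  by rewrite /row_vector mulr_sumr; apply: eq_bigr => i _; rewrite -mulrA [K i j * _]mulrC.
have sumca : \sum_i M i (enum_rank a) * K i j = (ca *m K) 0 j.
  by rewrite !mxE; apply: eq_bigr => i _; rewrite mxE.
exists (fun i => Num.sg ((ca *m K) 0 j) * K i j) => [b bZ|].
  rewrite sumE; suff -> : \sum_i M i (enum_rank b) * K i j = 0 by rewrite mulr0.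
  have := congr1 (fun X : 'M_(_, _) => X (enum_rank b) j) MZK.
  rewrite !mxE => MK0; rewrite -[RHS]MK0; apply: eq_bigr => i _.
  by rewrite !mxE enum_rankK bZ mulr1n.
by rewrite sumE sumca -normrEsg normr_gt0.
Qed.

(* Minty's painting lemma: relax the sign constraint at [b] into "free" on one
   side and "zero" on the other; if neither relaxation solves the problem, the
   two vectors so obtained have a positive scalar product. *)
Theorem painting (P Z : {set A}) a : a \in P -> [disjoint P & Z] ->
  (exists2 y, forall b, b \in Z -> row_vector y b = 0 &
     (forall b, b \in P -> 0 <= row_vector y b) /\ 0 < row_vector y a) \/
  (exists2 u, dependency u & [/\ forall b, b \notin P :|: Z -> u b = 0,
     forall b, b \in P -> 0 <= u b & 0 < u a]).
Proof.
have [n] := ubnP #|P|; elim: n P Z => // n IHn P Z Pn aP PZ.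
have [P1|] := boolP (P \subset [set a]).
  have {}P1 : P = [set a] by apply/eqP; rewrite finset.eqEsubset P1 finset.sub1set.
  have aZ : a \notin Z by move: PZ; rewrite P1 disjoints1.
  have [[y yZ ya]|[u du [uaZ ua]]] := painting1 aZ.
    by left; exists y => //; split=> // b; rewrite P1 inE => /eqP->; exact: ltW.
  right; exists u => //; split=> // b; rewrite P1; first exact: uaZ.
  by rewrite inE => /eqP->; exact: ltW.
move=> /subsetPn[b bP]; rewrite inE => ba.
have P'n : (#|P :\ b| < n)%N by move: Pn; rewrite (cardsD1 b P) bP.
have aP' : a \in P :\ b by rewrite !inE eq_sym ba.
have P'Z : [disjoint P :\ b & Z] by apply: disjointWl PZ; exact: subD1set.
have bZ : b \notin Z by rewrite (disjointFr PZ).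
have P'bZ : [disjoint P :\ b & b |: Z].
  rewrite -setI_eq0; apply/eqP/setP => c; rewrite !inE.
  have [->|_] := eqVneq c b => //=; apply/negbTE/negP => /andP[cP cZ].
  by rewrite (disjointFr PZ cP) in cZ.
have [[y1 y1Z [y1P y1a]]|[u du [u0 uP ua]]] := IHn _ _ P'n aP' P'Z; last first.
  right; exists u => //; split=> // c cP.
    by apply: u0; apply: contra cP; rewrite !inE => /orP[/andP[_ ->]|->]; rewrite ?orbT.
  have [->|cb] := eqVneq c b; last by apply: uP; rewrite !inE cb.
  by rewrite u0 // !inE eqxx (negbTE bZ).
have [y1b|y1b] := leP 0 (row_vector y1 b).
  left; exists y1 => //; split=> // c cP; have [->//|cb] := eqVneq c b.
  by apply: y1P; rewrite !inE cb.
have [[y2 y2Z [y2P y2a]]|[u du [u0 uP ua]]] := IHn _ _ P'n aP' P'bZ.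
  left; exists y2 => [c cZ|]; first by apply: y2Z; rewrite inE cZ orbT.
  split=> // c cP; have [->|cb] := eqVneq c b; first by rewrite y2Z // setU11.
  by apply: y2P; rewrite !inE cb.
have [ub|ub] := leP 0 (u b).
  right; exists u => //; split=> // c cP.
    apply: u0; apply: contra cP; rewrite !inE => /or3P[/andP[_ ->]|/eqP->|->] //.
      by rewrite bP.
    by rewrite orbT.
  by have [->//|cb] := eqVneq c b; apply: uP; rewrite !inE cb.
(* Off [a] every product is nonnegative: both factors are negative at [b] and nonnegative on the
   rest of [P], and one of them is zero elsewhere. The positive term at [a] then contradicts
   orthogonality. *)
have /eqP := row_vector_orth y1 du; rewrite (bigD1 a) //= => /eqP sum0.
have : 0 < row_vector y1 a * u a by rewrite mulr_gt0.
suff : 0 <= \sum_(c | c != a) row_vector y1 c * u c by move: sum0; lra.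
apply: sumr_ge0 => c _; have [->|cb] := eqVneq c b.
  by rewrite mulr_le0 // ltW.
have [cP|cP] := boolP (c \in P); first by rewrite mulr_ge0 ?y1P ?uP // !inE cb.
have [cZ|cZ] := boolP (c \in Z); first by rewrite y1Z ?mul0r.
by rewrite u0 ?mulr0 // !inE (negbTE cb) (negbTE cP).
Qed.

End RegularMatroid.

(** * Cells of coflows *)

Section Cells.

Variables (R : realType) (A : finType) (N : {set signed_set A}).
Hypotheses (omN : oriented_matroid N) (regN : regular R N).

Implicit Types (w : A -> R) (a b c : A) (C : signed_set A) (S T : {set A}).

Definition real_coflow w := forall C, C \in N -> \sum_a (circuit_vector C a)%:~R * w a = 0.

Lemma circuit_vector_pos C a : C \in N -> a \in C.1 -> circuit_vector C a = 1.
Proof.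
move=> /(om_disjoint omN) dC aC; rewrite /circuit_vector aC.
by rewrite (disjointFr dC aC) subr0.
Qed.

Lemma circuit_vector_neg C a : C \in N -> a \in C.2 -> circuit_vector C a = -1.
Proof.
move=> /(om_disjoint omN) dC aC; rewrite /circuit_vector aC.
by rewrite (disjointFl dC aC) sub0r.
Qed.

Lemma circuit_vector0 C a : a \notin supp C -> circuit_vector C a = 0.
Proof. by rewrite inE negb_or /circuit_vector => /andP[/negbTE-> /negbTE->]. Qed.

Lemma circuit_vector_supp C a : C \in N -> a \in supp C ->
  circuit_vector C a = 1 \/ circuit_vector C a = -1.
Proof.
move=> CN; rewrite inE => /orP[]aC; first by left; exact: circuit_vector_pos.
by right; exact: circuit_vector_neg.
Qed.

(** The painting lemma freed from the matrix: a dependency is refined to a conformal circuit through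
    [a], and row combinations are orthogonal to all circuit vectors. *)
Lemma coflow_or_circuit (P Z : {set A}) a : a \in P -> [disjoint P & Z] ->
  (exists2 w, real_coflow w & [/\ forall b, b \in Z -> w b = 0,
     forall b, b \in P -> 0 <= w b & 0 < w a]) \/
  (exists2 C, C \in N & [/\ a \in C.1, supp C \subset P :|: Z & [disjoint C.2 & P]]).
Proof.
have [m [M [tuM repM]]] := regN.
move=> aP PZ; have [[y yZ [yP ya]]|[u du [u0 uP ua]]] := painting M aP PZ.
  left; exists (row_vector M y); last by split.
  move=> C CN; under eq_bigr do rewrite mulrC.
  exact/row_vector_orth/(circuit_vector_dependency tuM repM CN).
right; have [C CN [aC C1 C2]] := conformal_circuit repM du (lt0r_neq0 ua).
exists C => //; split.
- by move: aC; rewrite inE => /orP[//|/C2]; rewrite ltNge ltW.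
- apply/fintype.subsetP => b; rewrite [b \in supp C]inE => bC; apply/negPn/negP => /u0 ub.
  by case/orP: bC => [/C1|/C2]; rewrite ub ltxx.
- rewrite disjoint_subset; apply/fintype.subsetP => b /C2 ub; rewrite inE.
  by apply/negP => /uP; rewrite leNgt ub.
Qed.

Lemma independent_circuit S b : independent N S -> ~~ independent N (b |: S) ->
  exists2 C, C \in N & b \in supp C /\ supp C \subset b |: S.
Proof.
move=> /forall_inP indS /forall_inPn[C CN]; rewrite negbK => CS; exists C => //.
split=> //; apply/negPn/negP => bC; have /negP := indS C CN; apply.
apply/fintype.subsetP => c cC; have := fintype.subsetP CS c cC.
by rewrite !inE => /orP[/eqP cb|//]; rewrite cb (negbTE bC) in cC.
Qed.

Lemma independent_subset S T : S \subset T -> independent N T -> independent N S.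
Proof.
move=> ST /forall_inP indT; apply/forall_inP => C CN.
by apply: contra (indT C CN) => /fintype.subset_trans; apply.
Qed.

Lemma basis_exists S : exists B : {set A},
  [/\ B \subset S, independent N B, rk N S = #|B| &
      forall a, a \in S -> a \notin B -> ~~ independent N (a |: B)].
Proof.
pose P := [pred I : {set A} | (I \subset S) && independent N I].
have P0 : P finset.set0.
  rewrite /P /= finset.sub0set; apply/forall_inP => C CN; rewrite finset.subset0.
  exact: om_nonempty omN _ CN.
have [B /andP[BS indB] Bmax] := arg_maxnP (fun I : {set A} => #|I|) P0.
exists B; split=> //; last first.
  move=> a aS aB; apply/negP => indaB; have := Bmax (a |: B).
  by rewrite /P /= indaB finset.subUset finset.sub1set aS BS cardsU1 aB ltnn => /(_ isT).
apply/eqP; rewrite eqn_leq; apply/andP; split; first exact/bigmax_leqP.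
by apply: (@leq_bigmax_cond _ _ (fun I : {set A} => #|I|)); rewrite BS.
Qed.

Lemma rk_subset S T : S \subset T -> (rk N S <= rk N T)%N.
Proof.
move=> ST; have [B [BS indB -> _]] := basis_exists S.
apply: (@leq_bigmax_cond _ _ (fun I : {set A} => #|I|)).
by rewrite indB (fintype.subset_trans BS).
Qed.

Local Notation I := (option (A + A)).
Local Notation G := {ffun I -> int}.
Local Notation E := {ffun I -> R^o}.
Local Notation embed := (@embed R _).

Definition up a : I := Some (inl a).
Definition dn a : I := Some (inr a).

(* A weak coflow [f] modulo an odd [q] becomes the point with coordinates [2 f]
   ([up]), [q - 2 f] ([dn]) and [q] ([None]); the cell of [f] records the
   quotients by [q] of its circuit sums. *)
Definition cell_map (k : signed_set A -> int) (Z : {set I}) (x : E) :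
    {ffun (A + signed_set A + I) -> R^o} :=
  [ffun t => match t with
    | inl (inl a) => x (up a) + x (dn a) - x None
    | inl (inr C) => if C \in N then
        \sum_a (circuit_vector C a)%:~R * x (up a) - (k C + k C)%:~R * x None else 0
    | inr i => if i \in Z then x i else 0
    end].

Fact cell_map_is_linear k Z : linear (cell_map k Z).
Proof.
move=> t x y; apply/ffunP => -[[a|C]|i]; rewrite !ffunE /=.
- by rewrite /GRing.scale /=; ring.
- case: ifP => _; last by rewrite scaler0 addr0.
  under eq_bigr do rewrite !ffunE mulrDr.
  rewrite big_split /= /GRing.scale /= mulrBr mulr_sumr.
  under [X in X + _ - _]eq_bigr do rewrite mulrCA.
  by ring.
- by case: ifP => _; rewrite ?scaler0 ?addr0.
Qed.

HB.instance Definition _ k Z :=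
  GRing.isLinear.Build R E {ffun (A + signed_set A + I) -> R^o} _
    (cell_map k Z) (cell_map_is_linear k Z).

(* Locked, since unification would otherwise unfold it to a kernel when
   rewriting with [memv_cap] or [mem_hyperplane]. *)
Definition cell_space k (Z : {set I}) : {vspace E} :=
  locked (lker (linfun (cell_map k Z))).

Lemma mem_cell_space k (Z : {set I}) (x : E) : reflect
  [/\ forall a, x (up a) + x (dn a) = x None,
      forall C, C \in N ->
        \sum_a (circuit_vector C a)%:~R * x (up a) = (k C + k C)%:~R * x None &
      forall i, i \in Z -> x i = 0]
  (x \in cell_space k Z).
Proof.
rewrite /cell_space -lock memv_ker lfunE /=; apply: (iffP eqP) => [/ffunP H|[H1 H2 H3]].
  split=> [a|C CN|i iZ].
  - by have := H (inl (inl a)); rewrite !ffunE => /eqP; rewrite subr_eq0 => /eqP.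
  - by have := H (inl (inr C)); rewrite !ffunE CN => /eqP; rewrite subr_eq0 => /eqP.
  - by have := H (inr i); rewrite !ffunE iZ.
apply/ffunP => -[[a|C]|i]; rewrite !ffunE.
- by rewrite H1 subrr.
- by case: ifP => // CN; rewrite H2 ?subrr.
- by case: ifP => // iZ; rewrite H3.
Qed.

(** Displacement along a coflow at constant height, which preserves the sums of the [up] and [dn]
    coordinates. *)
Definition direction w : E :=
  [ffun i => match i with
    | Some (inl a) => w a | Some (inr a) => - w a | None => 0 end].

Lemma direction_cell_space k (Z : {set I}) w : real_coflow w ->
  (forall i, i \in Z -> direction w i = 0) -> direction w \in cell_space k Z.
Proof.
move=> cw wZ; apply/mem_cell_space; split=> // [a|C CN]; rewrite /direction !ffunE /=.
  by rewrite subrr.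
by rewrite mulr0 -[RHS](cw C CN); apply: eq_bigr => a _; rewrite ffunE.
Qed.

Lemma cell_space_bounded k (Z : {set I}) (x : E) : x \in cell_space k Z -> (forall i, 0 <= x i) ->
  forall i, x i <= x None.
Proof.
move=> /mem_cell_space[x1 _ _] x0 [[a|a]|] //.
  by have := x1 a; have := x0 (dn a); rewrite /up /dn; lra.
by have := x1 a; have := x0 (up a); rewrite /up /dn; lra.
Qed.

(** Call [a] fractional if [x (up a)] and [x (dn a)] are both nonzero. With no fractional element,
    [x] is a multiple of a 0/1 vector. Otherwise painting yields a coflow supported on fractional
    elements, along which a further coordinate can be killed, or a circuit through [a] with no other
    fractional element. The latter makes [x (up a)] an integral multiple of the height, although it
    lies strictly between zero and the height. *)
Lemma integral_vertex k (Z : {set I}) (x : E) : x \in cell_space k Z -> x != 0 ->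
  (forall i, 0 <= x i) ->
  exists v : G, [/\ embed v \in cell_space k Z, forall i, v i = 0 \/ v i = 1,
    v None = 1 & forall i, x i = 0 -> v i = 0].
Proof.
pose S (y : E) := [set i | y i != 0].
have [n] := ubnP #|S x|; elim: n x => // n IHn x Sn xV xn0 x0.
have xbd := cell_space_bounded xV x0.
have [x1 x2 x3] := mem_cell_space _ _ _ xV.
have q_gt0 : 0 < x None.
  rewrite lt_def x0 andbT; apply: contra xn0 => /eqP xN; apply/eqP/ffunP => i.
  by rewrite ffunE; apply/eqP; rewrite eq_le x0 -xN xbd.
have [[a [xa xa']]|nofrac] := pselect (exists a, x (up a) != 0 /\ x (dn a) != 0); last first.
  have int_x i : x i = 0 \/ x i = x None.
    have split_a a : x (up a) = 0 \/ x (dn a) = 0.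
      have [->|xa] := eqVneq (x (up a)) 0; first by left.
      have [->|xa'] := eqVneq (x (dn a)) 0; first by right.
      by case: nofrac; exists a.
    case: i => [[a|a]|]; last by right.
      by case: (split_a a); have := x1 a; rewrite /up /dn => + xa; rewrite xa => h; [left|right; lra].
    by case: (split_a a); have := x1 a; rewrite /up /dn => + xa; rewrite xa => h; [right; lra|left].
  pose v : G := [ffun i => if x i == 0 then 0 else 1].
  have vE : embed v = (x None)^-1 *: x.
    apply/ffunP => i; rewrite !ffunE /GRing.scale /=.
    have [->|xi] := eqVneq (x i) 0; first by rewrite mulr0.
    by case: (int_x i) => xi'; [rewrite xi' eqxx in xi|rewrite xi' mulVf ?lt0r_neq0].
  exists v; split=> [|i||i xi].
  - by rewrite vE rpredZ.
  - by rewrite ffunE; case: ifP; [left|right].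
  - by rewrite ffunE (negbTE (lt0r_neq0 q_gt0)).
  - by rewrite ffunE xi eqxx.
pose P := [set b | (x (up b) == 0) || (x (dn b) == 0)].
have aP : [disjoint [set a] & P] by rewrite disjoints1 inE negb_or xa.
have [[w cw [wP wa w_gt0]]|[C CN [aC CP _]]] := coflow_or_circuit (set11 a) aP.
  have supp_w i : direction w i != 0 -> x i != 0.
    have wb b : w b != 0 -> x (up b) != 0 /\ x (dn b) != 0.
      move=> wb; apply/andP; rewrite -negb_or; apply: contra wb => bP.
      by rewrite wP // inE.
    case: i => [[b|b]|]; rewrite ffunE ?oppr_eq0 ?eqxx //; by move/wb => [].
  (* As [w a] is positive, the direction agrees with [x] at [up a], which stays nonzero, and
     conflicts with [x] at [dn a], which guarantees a new zero. *)
  have [||t [ta [c xc tc] tpos tneg]] := @conformal_step R I x (direction w) (up a) (dn a) supp_w _ xa.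
  - by rewrite ffunE mulr_ge0 // ltW.
  - by rewrite ffunE mulrN oppr_lt0 mulr_gt0 // lt_def xa' x0.
  pose y : E := x + t *: direction w.
  have yE i : y i = x i + t * direction w i by rewrite !ffunE.
  have xy i : x i = 0 -> y i = 0.
    move=> xi; apply/eqP; rewrite yE; apply/negPn/negP; rewrite neq_lt => /orP[/tneg|/tpos];
    by rewrite xi ltxx.
  have [||||v [vV v01 v1 vy]] := IHn y.
  - suff: (#|S y| < #|S x|)%N by move: Sn; rewrite ltnS; lia.
    apply/proper_card/fintype.properP; split.
      by apply/fintype.subsetP => i; rewrite !inE; apply: contra => /eqP/xy->.
    by exists c; rewrite inE // yE tc eqxx.
  - rewrite rpredD // rpredZ //; apply: direction_cell_space => // i iZ.
    apply/eqP; apply: contraTT isT => /supp_w; rewrite x3 ?eqxx //.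
  - by apply: contraNneq ta => y0; rewrite -yE y0 ffunE.
  - by move=> i; rewrite leNgt; apply/negP; rewrite yE => /tneg; rewrite ltNge x0.
  by exists v; split=> // i /xy /vy.
have int_b b : b \in P -> exists z : int, x (up b) = z%:~R * x None.
  rewrite inE => /orP[]/eqP xb; first by exists 0; rewrite mul0r.
  by exists 1; have := x1 b; rewrite xb addr0 mul1r.
have [z zE] : exists z : int, \sum_(b | b != a) (circuit_vector C b)%:~R * x (up b)
    = z%:~R * x None.
  apply: (big_ind (fun s => exists z : int, s = z%:~R * x None)).
  - by exists 0; rewrite mul0r.
  - by move=> s1 s2 [z1 ->] [z2 ->]; exists (z1 + z2); rewrite intrD mulrDl.
  move=> b ba; have [bC|bC] := boolP (b \in supp C); last first.
    by exists 0; rewrite circuit_vector0 // !mul0r.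
  have /int_b[z ->] : b \in P.
    by have := fintype.subsetP CP b bC; rewrite !inE (negbTE ba).
  by exists (circuit_vector C b * z); rewrite intrM mulrA.
have := x2 C CN; rewrite (bigD1 a) //= zE circuit_vector_pos // mul1r => /eqP.
rewrite -subr_eq0 -addrA -mulrBl -intrB => /eqP xaE.
pose l := (k C + k C) - z.
have {}xaE : x (up a) = l%:~R * x None.
  by rewrite /l; move: xaE; rewrite !intrB !intrD; lra.
have xa_gt0 : 0 < x (up a) by rewrite lt_def xa x0.
have xa_lt : x (up a) < x None.
  by rewrite -(x1 a) ltrDl lt_def xa' x0.
move: xa_gt0 xa_lt; rewrite xaE pmulr_lgt0 // gtr_pMl // ltr0z ltrz1; lia.
Qed.

Lemma cell_space_vertexed k (Z : {set I}) : vertexed None (cell_space k Z).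
Proof.
split=> [x|Z' x xV xn0 x0 xZ']; first exact: cell_space_bounded.
have [v [vV v01 v1 vx]] := integral_vertex xV xn0 x0.
by exists v; split=> // i /xZ'/vx.
Qed.

Lemma cell_spaceU1 k i (Z : {set I}) :
  cell_space k (i |: Z) = (cell_space k Z :&: hyperplane R i)%VS.
Proof.
apply/vspaceP => x; rewrite memv_cap mem_hyperplane; apply/mem_cell_space/andP.
  case=> x1 x2 x3; split; last by rewrite x3 ?setU11.
  by apply/mem_cell_space; split=> // j jZ; rewrite x3 // setU1r.
case=> /mem_cell_space[x1 x2 x3] /eqP xi; split=> // j.
by rewrite !inE => /orP[/eqP->|/x3].
Qed.

(** A copy of the space of real coflows that vanish on [S]. At height zero all quotients give the
    same space, and [0] represents them. *)
Definition linear_part S := cell_space (fun=> 0) (None |: [set up a | a in S]).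

Lemma mem_linear_part S (x : E) : reflect
  [/\ x None = 0, forall a, x (dn a) = - x (up a), real_coflow (fun a => x (up a)) &
      forall a, a \in S -> x (up a) = 0]
  (x \in linear_part S).
Proof.
apply: (iffP (mem_cell_space _ _ _)) => [[x1 x2 x3]|[xN xd xc xS]].
  have xN : x None = 0 by apply: x3; rewrite setU11.
  split=> // [a|C CN|a aS].
  - by have := x1 a; rewrite xN => /eqP; rewrite addrC addr_eq0 => /eqP.
  - by rewrite x2 // xN mulr0.
  - by apply: x3; rewrite setU1r // imset_f.
split=> [a|C CN|i]; first by rewrite xd xN subrr.
- by rewrite xc // addr0 mul0r.
- by rewrite !inE => /orP[/eqP->//|/imsetP[a aS ->]]; exact: xS.
Qed.

(** No circuit lies inside [B], so painting gives a coflow that vanishes on [B :\ b] but not at [b]: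
    each element of [B] cuts the dimension by one. *)
Lemma dim_linear_part_independent (B : {set A}) : independent N B ->
  \dim (linear_part finset.set0) = (\dim (linear_part B) + #|B|)%N.
Proof.
have [n] := ubnP #|B|; elim: n B => // n IHn B Bn indB.
have [->|[b bB]] := set_0Vmem B; first by rewrite cards0 addn0.
have indB' : independent N (B :\ b) := independent_subset (subD1set B b) indB.
have Bb : (#|B :\ b| < n)%N by move: Bn; rewrite (cardsD1 b B) bB.
rewrite (IHn _ Bb indB') (cardsD1 b B) bB add1n addnS -addSn; congr (_ + _)%N.
have disj : [disjoint [set b] & B :\ b] by rewrite disjoints1 !inE eqxx.
have [[w cw [wB wb w_gt0]]|[C CN [bC CB _]]] := coflow_or_circuit (set11 b) disj.
  rewrite (@dim_cap_hyperplane _ _ _ (direction w) (up b)).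
  - congr (\dim _).+1; apply/vspaceP => x; rewrite memv_cap mem_hyperplane.
    apply/andP/idP => [[/mem_linear_part[xN xd xc xB] /eqP xb]|/mem_linear_part[xN xd xc xB]].
      apply/mem_linear_part; split=> // a aB; have [->//|ab] := eqVneq a b.
      by apply: xB; rewrite !inE ab.
    split; last by rewrite xB.
    by apply/mem_linear_part; split=> // a; rewrite !inE => /andP[_ /xB].
  - apply: direction_cell_space => // i; rewrite !inE => /orP[/eqP->|/imsetP[a aB ->]].
      by rewrite ffunE.
    by rewrite ffunE /= wB.
  - by rewrite ffunE lt0r_neq0.
have /forall_inP/(_ C CN)/negP := indB; case; apply: fintype.subset_trans CB _.
by rewrite finset.setD1K.
Qed.

(** A coflow that vanishes on a basis of [S] vanishes on [S], by the circuits made of one more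
    element and part of the basis. This applies to [S] and to the whole ground set, where only zero
    remains. *)
Lemma dim_linear_part S : (\dim (linear_part S) + rk N S = rk N [set: A]%SET)%N.
Proof.
have dimE (S' : {set A}) :
    \dim (linear_part finset.set0) = (\dim (linear_part S') + rk N S')%N.
  have [B [BS indB -> maxB]] := basis_exists S'.
  rewrite (dim_linear_part_independent indB); congr (\dim _ + _)%N.
  apply/vspaceP => x; apply/mem_linear_part/mem_linear_part => -[xN xd xc xB]; split=> //.
    move=> s sS; have [/xB//|sB] := boolP (s \in B).
    have [C CN [sC CB]] := independent_circuit indB (maxB s sS sB).
    have := xc C CN; rewrite (bigD1 s) //= big1 ?addr0; last first.
      move=> c cs; have [cC|cC] := boolP (c \in supp C); last first.
        by rewrite circuit_vector0 // mul0r.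
      by rewrite xB ?mulr0 //; have := fintype.subsetP CB c cC; rewrite !inE (negbTE cs).
    move/eqP; rewrite mulf_eq0 => /orP[|/eqP//].
    by case: (circuit_vector_supp CN sC) => ->; rewrite intr_eq0.
  by move=> a aB; rewrite xB // (fintype.subsetP BS).
rewrite -dimE (dimE [set: A]%SET); apply/eqP; rewrite -[X in _ == X]add0n eqn_add2r.
rewrite dimv_eq0 -subv0; apply/subvP => x /mem_linear_part[xN xd _ xA].
rewrite memv0; apply/eqP/ffunP => -[[a|a]|]; rewrite ffunE //.
  by rewrite xA // inE.
by rewrite xd xA ?oppr0 // inE.
Qed.

Lemma dim_cell_space k T (y : E) : y \in cell_space k [set up a | a in T] ->
  y None != 0 ->
  (\dim (cell_space k [set up a | a in T]) + rk N T = (rk N [set: A]%SET).+1)%N.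
Proof.
move=> yV yN; rewrite (dim_cap_hyperplane yV yN) -(dim_linear_part T) addSn.
congr (\dim _ + _).+1; rewrite -cell_spaceU1; apply/vspaceP => x.
apply/mem_cell_space/mem_cell_space => -[x1 x2 x3]; split=> // C CN; rewrite x2 //.
  by rewrite x3 ?setU11 // !mulr0.
by rewrite x3 ?setU11 // !mulr0.
Qed.

(** The coordinates that vanish on the whole cone. Imposing them passes to the span of the cone,
    whose relative interior is then where all other coordinates are positive. *)
Definition cell_zeros k : {set I} :=
  [set i | `[< forall x, x \in cell_space k finset.set0 -> (forall j, 0 <= x j) -> x i = 0 >]]%SET.

Lemma cell_space_nonneg k (x : E) : (forall i, 0 <= x i) ->
  (x \in cell_space k (cell_zeros k)) = (x \in cell_space k finset.set0).
Proof.
move=> x0; apply/mem_cell_space/mem_cell_space => -[x1 x2 x3].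
  by split=> // i; rewrite inE.
split=> // i; rewrite inE => /asboolP; apply=> //.
by apply/mem_cell_space.
Qed.

(** Sum, over the coordinates that are not forced to vanish, of a point of the cone that is positive
    there. *)
Lemma inner_point k : exists2 p : E, p \in cell_space k (cell_zeros k) &
  forall i, 0 <= p i /\ (p i == 0) = (i \in cell_zeros k).
Proof.
have /choice[f Hf] i : exists x : E, [/\ x \in cell_space k finset.set0, forall j, 0 <= x j &
    i \notin cell_zeros k -> x i != 0].
  have [iZ|iZ] := boolP (i \in cell_zeros k).
    by exists 0; split=> [|j|//]; rewrite ?rpred0 // ffunE.
  move: (iZ); rewrite inE => /asboolPn/existsNP[x /not_implyP[xV /not_implyP[x0 /eqP xi]]].
  by exists x.
have fV i : f i \in cell_space k finset.set0 by case: (Hf i).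
have f0 i j : 0 <= f i j by case: (Hf i) => _ h _; exact: h.
have pE j : (\sum_i f i) j = \sum_i f i j by rewrite sum_ffunE.
exists (\sum_i f i).
  rewrite cell_space_nonneg ?rpred_sum // => j; rewrite pE; exact: sumr_ge0.
move=> j; rewrite pE; split; first exact: sumr_ge0.
have [jZ|jZ] := boolP (j \in cell_zeros k).
  by rewrite big1 ?eqxx // => i _; move: jZ; rewrite inE => /asboolP; apply.
rewrite (bigD1 j) //= paddr_eq0 ?sumr_ge0 //.
by have [_ _ /(_ jZ)/negbTE->] := Hf j.
Qed.

(** Flat: a circuit through [a] with all other elements in the zero set would make [y (up a)] an
    integral multiple of the height, although it lies strictly between zero and the height. Cyclic:
    the zeros of [y] are zeros of the whole cone, so no small coflow can leave them. *)
Lemma inner_cyclic_flat k (y : E) : y \in cell_space k finset.set0 -> 0 < y None ->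
  (forall i, 0 <= y i) -> (forall a, y (dn a) != 0) ->
  (forall a, y (up a) = 0 -> up a \in cell_zeros k) ->
  cyclic_flat N [set a | y (up a) == 0]%SET.
Proof.
move=> yV yN y0 yd yZ; set T := [set a | _]%SET.
have [y1 y2 _] := mem_cell_space _ _ _ yV.
have mem_T a : (a \in T) = (y (up a) == 0) by rewrite inE.
apply/andP; split.
  apply/forallP => a; apply/implyP => aT.
  have [B [BT indB -> _]] := basis_exists T.
  have aB : a \notin B by apply: contra aT; exact: fintype.subsetP.
  have -> : (#|B|.+1 = #|a |: B|)%N by rewrite cardsU1 aB.
  apply: (@leq_bigmax_cond _ _ (fun J : {set A} => #|J|)); rewrite finset.setUS //=.
  apply/negPn/negP => /(independent_circuit indB)[C CN [aC CB]].
  have := y2 C CN; rewrite (bigD1 a) //= big1 ?addr0; last first.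
    move=> c ca; have [cC|cC] := boolP (c \in supp C); last first.
      by rewrite circuit_vector0 // mul0r.
    have cB : c \in B by have := fintype.subsetP CB c cC; rewrite !inE (negbTE ca).
    have := fintype.subsetP BT c cB; rewrite mem_T => /eqP->; exact: mulr0.
  have ya_gt0 : 0 < y (up a) by rewrite lt_def y0 andbT -mem_T.
  have ya_lt : y (up a) < y None by rewrite -(y1 a) ltrDl lt_def yd y0.
  have key (z : int) : y (up a) = z%:~R * y None -> False.
    move=> yaE; move: ya_gt0 ya_lt; rewrite yaE pmulr_lgt0 // gtr_pMl // ltr0z ltrz1; lia.
  move=> yaE; apply: (key (circuit_vector C a * (k C + k C))).
  rewrite intrM -mulrA -yaE mulrA -intrM.
  by case: (circuit_vector_supp CN aC) => ->; rewrite ?mulrNN !mul1r.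
apply/existsP; exists [set C | positive_circuit N C && (supp C \subset T)]%SET.
apply/andP; split; first by apply/forall_inP => C; rewrite inE => /andP[].
rewrite finset.eqEsubset; apply/andP; split; last first.
  by apply/finset.bigcupsP => C; rewrite inE => /andP[].
apply/fintype.subsetP => a aT.
(* Either a positive circuit inside [T] passes through [a], or a coflow that is nonnegative on [T]
   moves [y] within the cone to a point positive at [up a], against [yZ]. *)
have [|[w cw [_ wT w_gt0]]|[C CN [aC CT C2]]] := @coflow_or_circuit T finset.set0 a aT.
- by rewrite -setI_eq0 finset.setI0.
- have [e e0 He] := perturbation y (direction w).
  have yw i : 0 <= (y + e *: direction w) i.
    rewrite !ffunE /GRing.scale /=; have [yi|yi] := eqVneq (y i) 0; last first.
      by apply: ltW; have [h _] := He i; move: h; rewrite ffunE; apply; rewrite lt_def yi y0.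
    rewrite yi add0r mulr_ge0 ?(ltW e0) //; case: i yi => [[b|b]|] //.
      by move=> yb; apply: wT; rewrite mem_T yb.
    by move=> yb; have := yd b; rewrite /dn yb eqxx.
  have ywV : y + e *: direction w \in cell_space k finset.set0.
    by rewrite rpredD ?rpredZ //; apply: direction_cell_space => // i; rewrite inE.
  move: (aT); rewrite mem_T => /eqP/yZ; rewrite inE => /asboolP/(_ _ ywV yw).
  move: aT; rewrite mem_T !ffunE => /eqP->; rewrite add0r => /eqP.
  by rewrite mulf_eq0 (negbTE (lt0r_neq0 e0)) (negbTE (lt0r_neq0 w_gt0)).
- have {}CT : supp C \subset T by move: CT; rewrite finset.setU0.
  apply/finset.bigcupP; exists C; last by rewrite inE aC.
  rewrite inE /positive_circuit CN CT andbT -finset.subset0; apply/fintype.subsetP => b bC.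
  by have := disjointFr C2 bC; rewrite (fintype.subsetP CT) // inE bC orbT.
Qed.

(** A positive circuit inside [T] has sum zero at [y], so its quotient is zero; at any point of the
    cone its nonnegative terms then add up to zero. *)
Lemma cyclic_flat_zeros k T (y : E) : cyclic_flat N T ->
  y \in cell_space k finset.set0 -> 0 < y None -> (forall a, a \in T -> y (up a) = 0) ->
  forall a, a \in T -> up a \in cell_zeros k.
Proof.
move=> /andP[_ /existsP[P /andP[/forall_inP posP /eqP TE]]] yV yN yT a.
rewrite {1}TE => /finset.bigcupP[C CP aC].
have /andP[CN /eqP C2] := posP C CP.
have CT b : b \in C.1 -> b \in T.
  by move=> bC; rewrite TE; apply/finset.bigcupP; exists C => //; rewrite inE bC.
have aC1 : a \in C.1 by move: aC; rewrite inE C2 inE orbF.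
have sumC (x : E) : \sum_b (circuit_vector C b)%:~R * x (up b) = \sum_(b in C.1) x (up b).
  rewrite [RHS]big_mkcond; apply: eq_bigr => b _; rewrite /circuit_vector C2 inE subr0.
  by case: ifP; rewrite ?mul1r ?mul0r.
have kC : (k C + k C)%:~R = 0 :> R.
  have [_ y2 _] := mem_cell_space _ _ _ yV; have := y2 C CN.
  rewrite sumC big1 => [/esym/eqP|b /CT/yT //].
  by rewrite mulf_eq0 (negbTE (lt0r_neq0 yN)) orbF => /eqP.
rewrite inE; apply/asboolP => x /mem_cell_space[_ x2 _] x0.
have := x2 C CN; rewrite sumC kC mul0r => /eqP; rewrite psumr_eq0 //.
by move/allP/(_ a (mem_index_enum a)); rewrite aC1 => /eqP.
Qed.

End Cells.

(** * Counting *)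

Lemma hsum_card (I : finType) (i0 : I) (X : finType) (D : {set X})
    (h : X -> {ffun I -> int}) (phi : {ffun I -> int} -> int) (q c : int) :
  injective h -> (forall x, x \in D -> h x i0 = q /\ phi (h x) = c) ->
  (forall g : {ffun I -> int}, g i0 = q -> phi g != 0 -> exists2 x, x \in D & g = h x) ->
  hsum i0 phi q = c * #|D|%:Z.
Proof.
move=> h_inj hD Dh; rewrite /hsum.
rewrite -(@fsbig_widen _ _ _ _ [set h x | x in [set` D]]%classic) //; last first.
  move=> g [_ /= gD]; case: eqP => // gq; apply/eqP; apply: contra_notT gD => /(Dh g gq)[x xD ->].
  by exists x.
rewrite fsbig_image; last by move=> x y _ _; exact: h_inj.
have -> : [set` D]%classic = [set` enum D]%classic.
  by apply/seteqP; split=> x /=; rewrite mem_enum.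
rewrite -fsbig_seq ?enum_uniq // big_enum /=.
rewrite (eq_bigr (fun=> c)) => [|x xD]; last by have [-> ->] := hD x xD; rewrite eqxx.
by rewrite sumr_const -mulr_natr natz.
Qed.

Lemma odd_values_inj (p r : {poly rat}) :
  (forall q : nat, odd q -> p.[q%:R] = r.[q%:R]) -> p = r.
Proof.
move=> pr; apply/eqP; rewrite -subr_eq0; apply/eqP.
pose s : seq rat := [seq (i.*2.+1)%:R | i <- iota 0 (size (p - r))].
apply: (@roots_geq_poly_eq0 _ _ s).
- apply/allP => _ /mapP[i _ ->]; rewrite rootE hornerD hornerN pr ?subrr //.
  by rewrite /= odd_double.
- rewrite map_inj_uniq ?iota_uniq // => i j /eqP; rewrite eqr_nat eqSS => /eqP.
  exact: double_inj.
- by rewrite size_map size_iota.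
Qed.

Lemma sum_sdiff (A : finType) (V : zmodType) (T S : {set A}) (f : A -> V) :
  (forall a, a \in T -> f a = 0) ->
  \sum_(x : {a | a \notin T} | val x \in S) f (val x) = \sum_(a in S) f a.
Proof.
move=> fT; rewrite [RHS](bigID (mem T)) /= [X in _ = X + _]big1 ?add0r; last first.
  by move=> a /andP[_ /fT].
rewrite (eq_bigl (fun a => (a \in [predC T]) && (a \in S))); last first.
  by move=> a; rewrite inE andbC.
by rewrite big_sub_cond.
Qed.

Lemma sum_circuit_vector (A : finType) (V : zmodType) (C : signed_set A) (f : A -> V) :
  \sum_a f a *~ circuit_vector C a = \sum_(a in C.1) f a - \sum_(a in C.2) f a.
Proof.
under eq_bigr do rewrite mulrzBr.
rewrite sumrB; congr (_ - _); rewrite [RHS]big_mkcond; apply: eq_bigr => a _;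
by case: (a \in _); rewrite ?mulr1z ?mulr0z.
Qed.

(** * Coflows of a contraction *)

Section Contraction.

Variables (R : realType) (A : finType) (N : {set signed_set A}).
Hypotheses (omN : oriented_matroid N) (regN : regular R N).

(** The trace of a circuit outside [T] need not be a circuit of the contraction. The claim is
    therefore extended to all integral dependencies, from which multiples of circuits with minimal
    trace are subtracted until nothing is left outside [T]. *)
Lemma contract_coflow (V : zmodType) (f : A -> V) (T : {set A}) :
  (forall a, a \in T -> f a = 0) ->
  (forall Y, Y \in contract N T ->
     \sum_(x in Y.1) f (val x) - \sum_(x in Y.2) f (val x) = 0) <->
  (forall C, C \in N -> \sum_(a in C.1) f a - \sum_(a in C.2) f a = 0).
Proof.
move=> fT.
have sdiffE C : \sum_(x in (sdiff T C).1) f (val x) - \sum_(x in (sdiff T C).2) f (val x) =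
    \sum_(a in C.1) f a - \sum_(a in C.2) f a.
  by congr (_ - _); rewrite -(sum_sdiff _ fT); apply: eq_bigl => x; rewrite inE.
split=> [cY C CN|cN Y]; last first.
  rewrite /contract inE => /andP[]; rewrite inE => /andP[/imsetP[C CN ->] _] _.
  by rewrite sdiffE cN.
have [m [M [tuM repM]]] := regN.
have depN := circuit_vector_dependency tuM repM.
suff key (u : A -> int) : dependency M (fun a => (u a)%:~R) -> \sum_a f a *~ u a = 0.
  by rewrite -sum_circuit_vector; apply: key; exact: depN.
pose U (u : A -> int) := [set x : {a | a \notin T} | u (val x) != 0].
have [n] := ubnP #|U u|; elim: n u => // n IHn u Un du.
have [U0|[x0 x0U]] := set_0Vmem (U u).
  rewrite big1 // => a _; have [aT|aT] := boolP (a \in T); first by rewrite fT ?mul0rz.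
  have [->|ua] := eqVneq (u a) 0; first by rewrite mulr0z.
  have : Sub a aT \in U u by rewrite inE SubK.
  by rewrite U0 inE.
have suppE D x : (x \in supp (sdiff T D)) = (val x \in supp D) by rewrite !inE.
pose P D := [&& D \in N, supp (sdiff T D) != finset.set0 & supp (sdiff T D) \subset U u].
have [D0 PD0] : exists D0, P D0.
  have ux0 : (u (val x0))%:~R != 0 :> R by move: x0U; rewrite inE intr_eq0.
  have [D DN [xD D1 D2]] := conformal_circuit repM du ux0.
  exists D; apply/and3P; split=> //.
    by apply/set0Pn; exists x0; rewrite suppE.
  apply/fintype.subsetP => x; rewrite suppE !inE => /orP[/D1|/D2]; rewrite ?ltr0z ?ltrz0 => h.
    exact: lt0r_neq0.
  exact: ltr0_neq0.
have [D /and3P[DN Dn0 DU] Dmin] := arg_minnP (fun D => #|supp (sdiff T D)|) PD0.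
have DY : sdiff T D \in contract N T.
  rewrite inE inE imset_f // Dn0 /=; apply/forall_inP => Y.
  rewrite inE => /andP[/imsetP[D' D'N ->] D'n0]; apply/implyP => D'D.
  rewrite eqEcard D'D; apply: Dmin; apply/and3P; split=> //.
  exact: fintype.subset_trans DU.
have /set0Pn[x xD] := Dn0.
(* The circuit vector is [1] or [-1] at [x], so subtracting this multiple cancels [u] there. *)
pose e : int := circuit_vector D (val x) * u (val x).
pose u' a := u a - e * circuit_vector D a.
have u'n : (#|U u'| < n)%N.
  suff: (#|U u'| < #|U u|)%N by move: Un; rewrite ltnS; lia.
  apply/proper_card/fintype.properP; split.
    apply/fintype.subsetP => y; rewrite !inE; apply: contra => /eqP uy.
    rewrite /u' uy circuit_vector0 ?mulr0 ?subr0 //.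
    by rewrite -suppE; apply/negP => /(fintype.subsetP DU); rewrite inE uy eqxx.
  exists x; first exact: fintype.subsetP DU x xD.
  rewrite inE negbK /u' /e; move: xD; rewrite suppE => xD.
  by case: (circuit_vector_supp omN DN xD) => ->; apply/eqP; ring.
have du' : dependency M (fun a => (u' a)%:~R).
  move=> i; rewrite -[RHS](dependencyD (- e%:~R) du (depN D DN) i).
  by apply: eq_bigr => a _; rewrite /u' intrB intrM mulNr.
have uE a : u a = u' a + circuit_vector D a * e by rewrite /u'; ring.
under eq_bigr do rewrite uE mulrzDr mulrzA.
rewrite big_split /= (IHn u' u'n du') add0r -mulrz_suml sum_circuit_vector -sdiffE.
by rewrite cY ?mul0rz.
Qed.

End Contraction.

(** * Weak coflows as lattice points of the cells *)

Section Counting.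

Variables (R : realType) (A : finType) (N : {set signed_set A}).
Hypotheses (omN : oriented_matroid N) (regN : regular R N).

Local Notation I := (option (A + A)).
Local Notation G := {ffun I -> int}.
Local Notation E := {ffun I -> R^o}.
Local Notation embed := (@embed R _).

Definition weak_coflows q : {set {ffun A -> 'I_q.-1.+1}} :=
  [set f | coflow N f && [forall a, (0 <= f a <= q./2)%N]]%SET.

Definition zero_set (q : nat) (f : {ffun A -> 'I_q.-1.+1}) : {set A} := [set a | f a == 0]%SET.

(** Computed in the integers, on representatives: divisibility by [q] is the coflow condition, and
    the quotient selects the cell. *)
Definition circuit_sum (q : nat) (f : {ffun A -> 'I_q.-1.+1}) (C : signed_set A) : int :=
  \sum_a circuit_vector C a * (f a : nat)%:Z.

(** The bijection is extension by zero on [T]. *)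
Lemma strict_count_contract (q : nat) (T : {set A}) : odd q ->
  strict_count (contract N T) q = #|[set f in weak_coflows q | zero_set f == T]|.
Proof.
move=> oddq; rewrite /strict_count.
set D := [set f : {ffun {a | a \notin T} -> _} | _].
pose ext (f : {ffun {a | a \notin T} -> 'I_q.-1.+1}) : {ffun A -> 'I_q.-1.+1} :=
  [ffun a => oapp f 0 (insub a)].
have extE f x : ext f (val x) = f x by rewrite ffunE valK.
have ext0 f a : a \in T -> ext f a = 0 by move=> aT; rewrite ffunE insubN ?negbK.
have ext_inj : injective ext.
  by move=> f g fg; apply/ffunP => x; rewrite -!extE fg.
rewrite -(card_imset (mem D) ext_inj); apply: eq_card => f; rewrite !inE.
have coflow_ext f' : coflow (contract N T) f' = coflow N (ext f').
  have cE := contract_coflow omN regN (ext0 f').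
  apply/forall_inP/forall_inP => [cf C CN|cf C CN]; apply/eqP.
    apply: cE.1 C CN => Y YN; have /eqP := cf Y YN.
    by under eq_bigr do rewrite -extE; under [X in _ - X = _]eq_bigr do rewrite -extE.
  under eq_bigr do rewrite -extE; under [X in _ - X = _]eq_bigr do rewrite -extE.
  by apply: cE.2 C CN => C CN; exact/eqP/cf.
have val_eq0 (z : 'I_q.-1.+1) : (z == 0) = (z == 0 :> nat)%N by [].
apply/imsetP/andP => [[f' + ->]|[/andP[cf /forallP fle] /eqP fT]].
  rewrite inE => /andP[cf /forallP f'le]; split; [apply/andP; split|].
  - by rewrite -coflow_ext.
  - apply/forallP => a; have [aT|aT] := boolP (a \in T); first by rewrite ext0.
    by rewrite -[a]/(val (Sub a aT : {a | a \notin T})) extE; case/andP: (f'le (Sub a aT)).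
  - apply/eqP/setP => a; rewrite inE; have [aT|aT] := boolP (a \in T).
      by rewrite ext0 // eqxx.
    rewrite -[a]/(val (Sub a aT : {a | a \notin T})) extE val_eq0.
    by apply/negbTE; rewrite -lt0n; case/andP: (f'le (Sub a aT)).
pose f' := [ffun x : {a | a \notin T} => f (val x)].
have fE : f = ext f'.
  apply/ffunP => a; have [aT|aT] := boolP (a \in T).
    by rewrite ext0 //; move: aT; rewrite -fT inE => /eqP.
  by rewrite -[a]/(val (Sub a aT : {a | a \notin T})) extE ffunE.
exists f' => //; rewrite inE coflow_ext -fE cf /=; apply/forallP => x.
rewrite ffunE; have /andP[_ ->] := fle (val x); rewrite andbT.
have : val x \notin zero_set f by rewrite fT; exact: (valP x).
by rewrite inE val_eq0 -lt0n.
Qed.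

Lemma val_sum_ord (n : nat) (S : {set A}) (f : A -> 'I_n.+1) :
  (\sum_(a in S) f a : 'I_n.+1) = ((\sum_(a in S) (f a : nat)) %% n.+1)%N :> nat.
Proof.
elim/big_rec2: _ => [|a x y _ IH]; first by rewrite mod0n.
by rewrite /= IH modnDmr.
Qed.

Lemma circuit_sumE (q : nat) (f : {ffun A -> 'I_q.-1.+1}) C :
  circuit_sum f C = (\sum_(a in C.1) (f a : nat))%N%:Z - (\sum_(a in C.2) (f a : nat))%N%:Z.
Proof.
rewrite !(big_morph Posz PoszD (erefl _)) -sum_circuit_vector.
by apply: eq_bigr => a _; rewrite mulrzz mulrC.
Qed.

Lemma coflowP (q : nat) (f : {ffun A -> 'I_q.-1.+1}) : (0 < q)%N ->
  reflect (forall C, C \in N -> (q%:Z %| circuit_sum f C)%Z) (coflow N f).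
Proof.
case: q f => // n f _.
have E (C : signed_set A) : (\sum_(a in C.1) f a - \sum_(a in C.2) f a == 0) = (n.+1%:Z %| circuit_sum f C)%Z.
  rewrite subr_eq0 -val_eqE /= !val_sum_ord circuit_sumE -eqz_mod_dvd.
  by rewrite !modz_nat eqz_nat.
by apply: (iffP forall_inP) => H C /H; rewrite E.
Qed.

Lemma weak_coflowP (q : nat) (f : {ffun A -> 'I_q.-1.+1}) : (0 < q)%N ->
  reflect ((forall C, C \in N -> (q%:Z %| circuit_sum f C)%Z) /\ forall a, (f a <= q./2)%N)
    (f \in weak_coflows q).
Proof.
move=> q0; rewrite inE; apply: (iffP andP) => [[/(coflowP _ q0) H /forallP le]|[H le]].
  by split=> // a; have := le a.
by split; [exact/coflowP|apply/forallP].
Qed.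

Local Notation n := #|A|.
Local Notation cell := {ffun signed_set A -> 'I_(n + n).+1}.

(* Circuit sums of weak coflows lie between [- n q] and [n q]; the quotients
   are shifted by [n] to index the cells by a finite type. *)
Definition cell_quotient (k : cell) (C : signed_set A) : int := (k C : nat)%:Z - n%:Z.

Definition cell_of q (f : {ffun A -> 'I_q.-1.+1}) : cell :=
  [ffun C => if C \in N then inord (absz ((circuit_sum f C %/ q%:Z)%Z + n%:Z)) else ord0].

(** Entries outside [N] do not affect the cone; fixing them leaves one index per system of
    quotients. *)
Definition valid_cell (k : cell) : bool := [forall C, (C \notin N) ==> (k C == ord0)].

Lemma cell_of_valid q (f : {ffun A -> 'I_q.-1.+1}) : valid_cell (cell_of f).
Proof. by apply/forallP => C; apply/implyP => /negbTE CN; rewrite ffunE CN. Qed.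

Lemma circuit_sum_bound (q : nat) (f : {ffun A -> 'I_q.-1.+1}) C :
  (0 < q)%N -> C \in N -> `|circuit_sum f C| <= n%:Z * q%:Z.
Proof.
move=> q0 CN; apply: le_trans (ler_norm_sum _ _ _) _.
have -> : n%:Z * q%:Z = \sum_(a : A) q%:Z by rewrite sumr_const -mulr_natl natz.
apply: ler_sum => a _; have fa : (f a < q)%N by apply: leq_trans (ltn_ord (f a)) _; lia.
have [aC|aC] := boolP (a \in supp C); last by rewrite circuit_vector0 // mul0r; lia.
by case: (circuit_vector_supp omN CN aC) => ->; lia.
Qed.

Lemma cell_quotient_of (q : nat) (f : {ffun A -> 'I_q.-1.+1}) C :
  (0 < q)%N -> f \in weak_coflows q -> C \in N ->
  cell_quotient (cell_of f) C * q%:Z = circuit_sum f C.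
Proof.
move=> q0 /(weak_coflowP _ q0)[qC _] CN; rewrite /cell_quotient ffunE CN.
have /dvdzP[z zE] := qC C CN; have := circuit_sum_bound f q0 CN.
have qn0 : q%:Z != 0 by rewrite eqz_nat -lt0n.
rewrite zE mulzK //.
rewrite normrM [`|q%:Z|]ger0_norm // ler_pM2r ?ltz_nat // => zn.
by rewrite inordK; [congr (_ * _); lia|lia].
Qed.

Definition point q (f : {ffun A -> 'I_q.-1.+1}) : G :=
  [ffun i => match i with
    | Some (inl a) => ((f a : nat) + f a)%N%:Z
    | Some (inr a) => q%:Z - ((f a : nat) + f a)%N%:Z
    | None => q%:Z
    end].

Definition even_point (g : G) : bool := [forall a, (2%:Z %| g (up a))%Z].

Lemma point_inj q : injective (@point q).
Proof.
move=> f f' /ffunP ff'; apply/ffunP => a; apply/val_inj => /=.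
by have := ff' (up a); rewrite !ffunE => -[]; rewrite !addnn => /double_inj.
Qed.

Lemma sum_embed (g : G) C : \sum_a (circuit_vector C a)%:~R * embed g (up a) =
  (\sum_a circuit_vector C a * g (up a))%:~R.
Proof.
by rewrite [RHS](big_morph _ (@intrD R) (mulr0z 1)); apply: eq_bigr => a _;
  rewrite embedE intrM.
Qed.

Lemma point_ge0 (q : nat) (f : {ffun A -> 'I_q.-1.+1}) : odd q -> f \in weak_coflows q ->
  (forall i, 0 <= point f i) /\ (forall a, 0 < point f (dn a)).
Proof.
move=> oddq /(weak_coflowP _ (odd_gt0 oddq))[_ fle].
have dnp a : 0 < point f (dn a).
  by rewrite ffunE /=; have := fle a; have := odd_double_half q; rewrite oddq; lia.
split=> // -[[a|a]|]; last by rewrite ffunE.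
  by rewrite ffunE.
exact/ltW/dnp.
Qed.

Lemma point_cell_space (q : nat) (f : {ffun A -> 'I_q.-1.+1}) : (0 < q)%N ->
  f \in weak_coflows q ->
  embed (point f) \in cell_space R N (cell_quotient (cell_of f)) finset.set0.
Proof.
move=> q0 fw; apply/mem_cell_space; split=> [a|C CN|i]; last by rewrite inE.
  by rewrite !embedE -intrD !ffunE /=; congr _%:~R; lia.
rewrite sum_embed embedE -intrM; congr _%:~R.
rewrite [point f None]ffunE mulrDl cell_quotient_of // -big_split /=.
by apply: eq_bigr => a _; rewrite ffunE /= PoszD mulrDr.
Qed.

Lemma even_pointP (q : nat) (f : {ffun A -> 'I_q.-1.+1}) : even_point (point f).
Proof. by apply/forallP => a; rewrite ffunE; apply/dvdzP; exists (f a : nat)%:Z; lia. Qed.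

(** The coflow is half of the [up] coordinates; as [q] is odd, nonnegativity of the [dn] coordinates
    is exactly the bound by [q./2]. *)
Lemma cell_space_point (q : nat) (k : cell) (g : G) : odd q -> valid_cell k ->
  embed g \in cell_space R N (cell_quotient k) finset.set0 -> (forall i, 0 <= g i) ->
  g None = q%:Z -> even_point g ->
  exists2 f, f \in [set f in weak_coflows q | cell_of f == k]%SET & g = point f.
Proof.
move=> oddq kv /mem_cell_space[g1 g2 _] g0 gq /forallP ge.
have q0 := odd_gt0 oddq.
have {}g1 a : g (up a) + g (dn a) = q%:Z.
  by apply/eqP; have := g1 a; rewrite !embedE -intrD gq => /eqP; rewrite eqr_int.
pose h a := absz (g (up a) %/ 2)%Z.
have hE a : g (up a) = (h a + h a)%N%:Z.
  by have /dvdzP[z zE] := ge a; have := g0 (up a); rewrite /h zE mulzK //; lia.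
have hle a : (h a <= q./2)%N.
  have := g1 a; have := g0 (dn a); rewrite hE; have := odd_double_half q; rewrite oddq; lia.
have hq a : (h a < q.-1.+1)%N.
  by rewrite prednK //; have := hle a; have := odd_double_half q; rewrite oddq; lia.
pose f : {ffun A -> 'I_q.-1.+1} := [ffun a => Ordinal (hq a)].
have fE a : f a = h a :> nat by rewrite ffunE.
have sumE C : C \in N -> circuit_sum f C = cell_quotient k C * q%:Z.
  move=> CN; have := g2 C CN; rewrite sum_embed embedE -intrM => /eqP.
  rewrite eqr_int gq => /eqP; rewrite /circuit_sum.
  under eq_bigr do rewrite hE PoszD mulrDr -fE.
  rewrite big_split /= mulrDl -!mulr2n => /eqP; rewrite eqrMn2r => /eqP <-.
  by apply: eq_bigr.
have fw : f \in weak_coflows q.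
  apply/weak_coflowP => //; split=> [C CN|a]; last by rewrite fE.
  by rewrite sumE // dvdz_mull.
exists f.
  rewrite inE fw /=; apply/eqP/ffunP => C; rewrite ffunE.
  case: ifP => CN; last by move/forallP/(_ C): kv; rewrite CN /= => /eqP->.
  rewrite sumE // mulzK; last by rewrite eqz_nat -lt0n.
  by apply/val_inj; rewrite /= /cell_quotient subrK absz_nat inordK.
apply/ffunP => -[[a|a]|]; rewrite ffunE.
- by rewrite /= fE -hE.
- by rewrite /= fE -(g1 a) hE addrAC subrr add0r.
- exact: gq.
Qed.

Definition forced_zeros (k : cell) : {set A} :=
  [set a | up a \in cell_zeros R N (cell_quotient k)]%SET.

Section CellCount.

Variables (k : cell) (p : E).
Hypothesis kv : valid_cell k.
Let Z := cell_zeros R N (cell_quotient k).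
Let V := cell_space R N (cell_quotient k) Z.
Hypotheses (pV : p \in V) (pZ : forall i, 0 <= p i /\ (p i == 0) = (i \in Z)).

Definition cell_count (q : int) : int :=
  hsum None (fun g => reciprocal V p g * (even_point g)%:R) q.

Lemma p_gt0 i : (0 < p i) = (i \notin Z).
Proof. by have [p0 <-] := pZ i; rewrite lt_def p0 andbT. Qed.

Lemma p_lt0 i : (p i < 0) = false.
Proof. by have [p0 _] := pZ i; apply/negbTE; rewrite -leNgt. Qed.

Lemma half_open_p (g : G) : half_open p g = [forall i, (i \notin Z) ==> (0 <= g i)].
Proof. by apply: eq_forallb => i; rewrite p_gt0 p_lt0 andbT. Qed.

Lemma half_open_pN (g : G) : half_open (- p) g = [forall i, (i \notin Z) ==> (0 < g i)].
Proof. by apply: eq_forallb => i; rewrite !ffunE oppr_gt0 oppr_lt0 p_lt0 p_gt0. Qed.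

Lemma mem_V_zero (g : G) i : embed g \in V -> i \in Z -> g i = 0.
Proof.
move=> /mem_cell_space[_ _ gZ] /gZ; rewrite embedE => /eqP; rewrite intr_eq0.
by move/eqP.
Qed.

Lemma mem_V_None (g : G) : embed g \in V -> g None != 0 -> None \notin Z.
Proof. by move=> gV; apply: contra => /(mem_V_zero gV)->. Qed.

(** At positive height the opposite cone contributes nothing. As [p] is a relative interior point,
    no facet is removed, and the whole closed cone is counted. *)
Lemma cell_countE (q : nat) : odd q ->
  cell_count q%:Z = #|[set f in weak_coflows q | cell_of f == k]%SET|%:Z.
Proof.
move=> oddq; have q0 := odd_gt0 oddq; rewrite /cell_count -[RHS]mul1r.
have rec_pos (g : G) : embed g \in V -> g None = q%:Z ->
    reciprocal V p g = (half_open p g)%:R.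
  move=> gV gq; rewrite /reciprocal gV half_open_pN.
  have NZ : None \notin Z by apply: (mem_V_None gV); rewrite gq; lia.
  have -> : [forall i, (i \notin Z) ==> (0 < (- g) i)] = false.
    by apply/negbTE/forallPn; exists None; rewrite NZ /= ffun_oppE gq; lia.
  by rewrite mulr0 subr0.
apply: (@hsum_card _ None _ _ (@point q)); first exact: point_inj.
  move=> f; rewrite inE => /andP[fw /eqP fk]; split; first by rewrite ffunE.
  have [f0 _] := point_ge0 oddq fw.
  have fV : embed (point f) \in V.
    rewrite /V /Z -fk cell_space_nonneg; first exact: point_cell_space.
    by move=> i; rewrite embedE ler0z.
  rewrite rec_pos ?ffunE // half_open_p even_pointP mulr1.
  by rewrite (_ : [forall i, _] = true) //; apply/forallP => i; rewrite f0 implybT.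
move=> g gq; rewrite mulf_eq0 negb_or => /andP[].
have [gV|gV] := boolP (embed g \in V); last by rewrite /reciprocal (negbTE gV) eqxx.
rewrite rec_pos // half_open_p !pnatr_eq0 !eqb0 !negbK => /forallP gpos ge.
have g0 i : 0 <= g i.
  have [iZ|iZ] := boolP (i \in Z); first by rewrite (mem_V_zero gV iZ).
  by have := gpos i; rewrite iZ.
apply: cell_space_point => //; rewrite -cell_space_nonneg //.
by move=> i; rewrite embedE ler0z.
Qed.

(** At negative height only the opposite of the relative interior contributes. Its points are the
    opposites of the coflows with no zero beyond those forced by the cell. *)
Lemma cell_countN (q : nat) : odd q ->
  cell_count (- q%:Z) = (-1) ^+ (rk N [set: A]%SET - rk N (forced_zeros k)) *
    #|[set f in weak_coflows q | (cell_of f == k) && (zero_set f == forced_zeros k)]%SET|%:Z.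
Proof.
move=> oddq; have q0 := odd_gt0 oddq; set D := [set f in _ | _]%SET.
have zeroE (f : {ffun A -> 'I_q.-1.+1}) a : (a \in zero_set f) = (point f (up a) == 0).
  by rewrite inE ffunE -val_eqE /= eqz_nat addn_eq0 andbb.
have rec_neg (g : G) : embed g \in V -> g None = - q%:Z ->
    reciprocal V p g = - (-1) ^+ (\dim V) * (half_open (- p) (- g))%:R.
  move=> gV gq; rewrite /reciprocal gV half_open_p.
  have NZ : None \notin Z by apply: (mem_V_None gV); rewrite gq; lia.
  have -> : [forall i, (i \notin Z) ==> (0 <= g i)] = false.
    by apply/negbTE/forallPn; exists None; rewrite NZ /= gq; lia.
  by rewrite sub0r mulNr.
have fV f : f \in D -> embed (point f) \in V.
  rewrite inE => /and3P[fw /eqP fk _]; rewrite /V /Z -fk cell_space_nonneg.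
    exact: point_cell_space.
  by move=> i; have [f0 _] := point_ge0 oddq fw; rewrite embedE ler0z.
have -> : cell_count (- q%:Z) = - (-1) ^+ (\dim V) * #|D|%:Z.
  apply: (@hsum_card _ None _ _ (fun f => - point f)).
  - by move=> f f' /oppr_inj/point_inj.
  - move=> f fD; rewrite ffun_oppE ffunE; split=> //.
    rewrite rec_neg; [|by rewrite embedN rpredN fV|by rewrite ffun_oppE ffunE].
    have -> : even_point (- point f).
      apply/forallP => a; rewrite ffun_oppE rpredN; exact: (forallP (even_pointP f)).
    rewrite opprK half_open_pN (_ : [forall i, _] = true) ?mulr1 //.
    move: (fD); rewrite inE => /and3P[fw _ /eqP fT].
    apply/forallP => -[[a|a]|]; apply/implyP => iZ.
    + have [f0 _] := point_ge0 oddq fw; rewrite lt_def f0 andbT -zeroE fT inE.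
      exact: iZ.
    + by have [_ fdn] := point_ge0 oddq fw; exact: fdn.
    + by rewrite ffunE ltz_nat.
  move=> g gq; rewrite mulf_eq0 negb_or => /andP[].
  have [gV|gV] := boolP (embed g \in V); last by rewrite /reciprocal (negbTE gV) eqxx.
  rewrite rec_neg // half_open_pN mulf_eq0 negb_or pnatr_eq0 eqb0 negbK.
  move=> /andP[_ /forallP gneg]; rewrite pnatr_eq0 eqb0 negbK => /forallP ge.
  have gVN : embed (- g) \in V by rewrite embedN rpredN.
  have g0 i : 0 <= (- g) i /\ ((- g) i == 0) = (i \in Z).
    have [iZ|iZ] := boolP (i \in Z); first by rewrite (mem_V_zero gVN iZ) eqxx.
    by have := gneg i; rewrite iZ /= => gi; rewrite ltW // gt_eqF.
  have [f] : exists2 f, f \in [set f in weak_coflows q | cell_of f == k]%SET & - g = point f.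
    apply: cell_space_point => //.
    - rewrite -cell_space_nonneg // => i; rewrite embedE ler0z; by case: (g0 i).
    - by move=> i; case: (g0 i).
    - by rewrite ffun_oppE gq opprK.
    - by apply/forallP => a; rewrite ffun_oppE rpredN; exact: ge.
  rewrite inE => /andP[fw fk] gf; exists f; last by rewrite -gf opprK.
  rewrite inE fw fk /=; apply/eqP/setP => a; rewrite zeroE -gf inE.
  by have [_ ->] := g0 (up a).
(* The formula for the dimension of [V] needs a point of nonzero height; if [D] is empty, both sides
   are zero anyway. *)
have [->|[f fD]] := set_0Vmem D; first by rewrite cards0 !mulr0.
congr (_ * _).
move: (fD); rewrite inE => /and3P[fw /eqP fk /eqP fT].
have ZE : Z = [set up a | a in forced_zeros k]%SET.
  apply/setP => -[[a|a]|]; apply/idP/imsetP => [iZ|[b bT]] //.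
  - by exists a => //; rewrite /forced_zeros inE; exact: iZ.
  - by case=> ->; move: bT; rewrite inE.
  - have [_ fdn] := point_ge0 oddq fw.
    by have := fdn a; rewrite (mem_V_zero (fV f fD) iZ) ltxx.
  - by have := mem_V_zero (fV f fD) iZ; rewrite ffunE; lia.
have := fV f fD; rewrite /V ZE => fV'.
have := dim_cell_space omN regN fV'; rewrite embedE ffunE intr_eq0 => dimE.
have {}dimE := dimE _.
have rkle : (rk N (forced_zeros k) <= rk N [set: A]%SET)%N.
  by apply: rk_subset; rewrite ?finset.subsetT.
(* The extra dimension, due to the height, absorbs the minus sign. *)
rewrite (_ : \dim _ = (rk N [set: A]%SET - rk N (forced_zeros k)).+1); last first.
  by have := dimE _; lia.
by rewrite exprS mulN1r opprK.
Qed.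

End CellCount.

End Counting.

(** * From one cell to the identity of polynomials *)

Lemma even_point_periodic (A : finType) : periodic2 (fun g => (@even_point A g)%:R).
Proof.
move=> g v; congr (_%:R); congr nat_of_bool; apply: eq_forallb => a.
rewrite !ffun_addE rpredDr //; apply/dvdzP; exists (v (up a)); lia.
Qed.

Lemma cell_polynomial (R : realType) (A : finType) (N : {set signed_set A})
    (omN : oriented_matroid N) (regN : regular R N)
    (k : {ffun signed_set A -> 'I_(#|A| + #|A|).+1}) (kv : valid_cell N k) :
  exists P : {poly rat}, forall q : nat, odd q ->
    P.[q%:R] = #|[set f in weak_coflows N q | cell_of N f == k]|%:R /\
    P.[- q%:R] = (-1) ^+ (rk N [set: A] - rk N (forced_zeros R N k)) *
      #|[set f in weak_coflows N q |
          (cell_of N f == k) && (zero_set f == forced_zeros R N k)]|%:R.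
Proof.
have [p pV pZ] := inner_point R N (cell_quotient k).
have p0 i : p i = 0 -> forall x, x \in
    cell_space R N (cell_quotient k) (cell_zeros R N (cell_quotient k)) -> x i = 0.
  move=> pi x /mem_cell_space[_ _ xZ]; apply: xZ.
  by have [_ <-] := pZ i; rewrite pi eqxx.
have [_ qp] := reciprocal_quasi_polynomial
  (cell_space_vertexed omN regN _ _) pV p0.
have [P0 HP0] := qp _ (even_point_periodic (A := A)) 1.
(* [P0] takes [m] for the height [m + m + 1]. Height [q] is [m = (q - 1) / 2], and height [- q] is
   [m = - (q./2) - 1]. *)
pose half : {poly rat} := 2%:R^-1 *: ('X - 1%:P).
have halfE (m : int) : (P0 \Po half).[(m + m + 1)%:~R] = P0.[m%:~R].
  rewrite horner_comp !hornerE; congr P0.[_].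
  by rewrite !intrD; field.
exists (P0 \Po half) => q oddq; have q2 := odd_double_half q; rewrite oddq /= in q2.
split.
  have -> : q%:R = ((q./2)%:Z + (q./2)%:Z + 1)%:~R :> rat.
    by rewrite -[LHS]/((q%:Z)%:~R); congr _%:~R; lia.
  rewrite halfE -HP0 (_ : _ + 1 = q%:Z); last by lia.
  by rewrite -/(cell_count _ _ _ _) cell_countE.
have -> : - q%:R = (- (q./2)%:Z - 1 + (- (q./2)%:Z - 1) + 1)%:~R :> rat.
  by rewrite -[q%:R]/((q%:Z)%:~R) -intrN; congr _%:~R; lia.
rewrite halfE -HP0 (_ : _ + 1 = - q%:Z); last by lia.
by rewrite -/(cell_count _ _ _ _) cell_countN // intrM rmorphXn rmorphN1.
Qed.

Theorem theorem7p1 (R : realType) (A : finType) (N : {set signed_set A})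
    (omN : oriented_matroid N) (regN : regular R N) :
  weak_charpoly N \Po (- 'X) =
  \sum_(T : {set A} | cyclic_flat N T)
    (-1) ^+ (rk N [set: A] - rk N T) *: strict_charpoly (contract N T).
Proof.
pose cell : finType := {ffun signed_set A -> 'I_(#|A| + #|A|).+1}.
have /choice[P HP] (k : cell) : exists P : {poly rat}, valid_cell N k ->
    forall q : nat, odd q ->
    P.[q%:R] = #|[set f in weak_coflows N q | cell_of N f == k]|%:R /\
    P.[- q%:R] = (-1) ^+ (rk N [set: A] - rk N (forced_zeros R N k)) *
      #|[set f in weak_coflows N q |
          (cell_of N f == k) && (zero_set f == forced_zeros R N k)]|%:R.
  have [kv|kv] := boolP (valid_cell N k); last by exists 0.
  by have [P HP] := cell_polynomial omN regN kv; exists P.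
have count_cells (q : nat) (a : pred {ffun A -> 'I_q.-1.+1}) :
    #|[set f in weak_coflows N q | a f]|%:R =
    \sum_(k | valid_cell N k) #|[set f in weak_coflows N q | (cell_of N f == k) && a f]|%:R :> rat.
  rewrite -natr_sum; congr _%:R; rewrite -sum1_card.
  rewrite (partition_big (fun f => cell_of N f : cell) (valid_cell N)); last first.
    by move=> f _; exact: cell_of_valid.
  apply: eq_bigr => k _; rewrite -sum1_card; apply: eq_bigl => f.
  by rewrite !inE; case: (_ == k); rewrite ?andbT ?andbF.
have evalN (p : {poly rat}) x : (p \Po (- 'X)).[x] = p.[- x].
  by rewrite horner_comp !hornerE.
have weakE : weak_charpoly N = \sum_(k | valid_cell N k) P k.
  have weak q : odd q -> (\sum_(k | valid_cell N k) P k).[q%:R] = (weak_count N q)%:R.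
    move=> oddq; rewrite horner_sum.
    have -> : weak_count N q = #|[set f in weak_coflows N q | predT f]|.
      by apply: eq_card => f; rewrite !inE andbT.
    rewrite count_cells; apply: eq_bigr => k kv; have [-> _] := HP k kv q oddq.
    by congr _%:R; apply: eq_card => f; rewrite !inE andbT.
  apply: xget_unique => // p Hp; apply: odd_values_inj => q oddq.
  by rewrite Hp // weak.
have mem_weak q (f : {ffun A -> 'I_q.-1.+1}) k : odd q -> f \in weak_coflows N q ->
    cell_of N f = k ->
    [/\ embed R (point f) \in cell_space R N (cell_quotient k) finset.set0,
        0 < embed R (point f) None, forall i, 0 <= embed R (point f) i,
        forall a, embed R (point f) (dn a) != 0 &
        forall a, (embed R (point f) (up a) == 0) = (a \in zero_set f)].
  move=> oddq fw fk; have [f0 fdn] := point_ge0 oddq fw; split=> [||i|a|a].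
  - by rewrite -fk; exact: point_cell_space (odd_gt0 oddq) fw.
  - by rewrite embedE ffunE ltr0z ltz_nat odd_gt0.
  - by rewrite embedE ler0z.
  - by rewrite embedE intr_eq0 lt0r_neq0.
  - by rewrite embedE intr_eq0 ffunE inE -val_eqE /= eqz_nat addn_eq0 andbb.
(* A coflow in the relative interior of the cell would make the forced zero set a cyclic flat, so
   the values at all [- q] are zero. *)
have PN0 k : valid_cell N k -> ~~ cyclic_flat N (forced_zeros R N k) -> P k \Po (- 'X) = 0.
  move=> kv ncyc; apply: odd_values_inj => q oddq; rewrite evalN horner0.
  have [_ ->] := HP k kv q oddq.
  rewrite (_ : [set f in _ | _] = finset.set0) ?cards0 ?mulr0 //.
  apply/eqP; rewrite -finset.subset0; apply/fintype.subsetP => f; rewrite inE.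
  move=> /and3P[fw /eqP fk /eqP fT]; exfalso; case/negP: ncyc.
  have [fV fN f0 fdn fup] := mem_weak q f k oddq fw fk.
  have := inner_cyclic_flat omN regN fV fN f0 fdn.
  rewrite (_ : [set a | _] = forced_zeros R N k); last first.
    by rewrite -fT; apply/setP => a; rewrite inE fup.
  by apply=> a /eqP; rewrite fup fT inE.
(* The cells with forced zero set [T] are collected, the leading sign undoing theirs. Agreement at
   all odd [q] also proves that the strict polynomial exists. *)
have strictE T : cyclic_flat N T -> strict_charpoly (contract N T) =
    (-1) ^+ (rk N [set: A] - rk N T) *:
      \sum_(k | valid_cell N k && (forced_zeros R N k == T)) (P k \Po (- 'X)).
  move=> cycT; set S := _ *: _.
  have strict q : odd q -> S.[q%:R] = (strict_count (contract N T) q)%:R.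
    move=> oddq; rewrite (strict_count_contract omN regN T oddq) count_cells.
    rewrite hornerZ horner_sum mulr_sumr [RHS](bigID (fun k => forced_zeros R N k == T)) /=.
    (* A coflow whose zero set is the cyclic flat [T] lies in a cell that forces exactly [T] to
       vanish, so the other cells contain none. *)
    rewrite [X in _ = _ + X]big1 ?addr0 => [|k /andP[kv kT]]; last first.
      rewrite (_ : [set f in _ | _] = finset.set0) ?cards0 //.
      apply/eqP; rewrite -finset.subset0; apply/fintype.subsetP => f; rewrite inE.
      move=> /and3P[fw /eqP fk /eqP fT].
      have [fV fN f0 fdn fup] := mem_weak q f k oddq fw fk.
      exfalso; case/eqP: kT; apply/setP => a; apply/idP/idP; rewrite inE => aT.
        rewrite -fT -fup; apply/eqP; move: aT; rewrite inE => /asboolP; exact.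
      apply: (cyclic_flat_zeros cycT fV fN) aT => b; rewrite -fT => bT.
      by apply/eqP; rewrite fup.
    apply: eq_bigr => k /andP[kv /eqP kT]; rewrite evalN.
    have [_ ->] := HP k kv q oddq; rewrite kT mulrA -exprMn mulrNN mulr1 expr1n mul1r.
    by [].
  apply: xget_unique => // p Hp; apply: odd_values_inj => q oddq.
  by rewrite Hp // strict.
(* Cells whose forced zero set is not a cyclic flat drop out; the others are grouped by that set. *)
rewrite weakE raddf_sum /= (bigID (fun k => cyclic_flat N (forced_zeros R N k))) /=.
rewrite [X in _ + X]big1 ?addr0 => [|k /andP[]]; last exact: PN0.
rewrite (partition_big (forced_zeros R N) (cyclic_flat N)) => [|k /andP[]//].
apply: eq_bigr => T cycT; rewrite strictE // scalerA -exprMn mulrNN mulr1 expr1n scale1r.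
apply: eq_bigl => k; have [->|] := eqVneq (forced_zeros R N k) T; last by rewrite !andbF.
by rewrite cycT !andbT.
Qed.
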